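(* Let $A\in\mathbb{R}^{n\times n}$ be a nonnegative, irreducible, diagonally symmetrizable matrix with null diagonal, let $\delta_i=\sum_{j=1}^n a_{ij}$, $\Delta=\mathrm{diag}\{\delta_1,\dots,\delta_n\}$ and $H_1=\Delta^{-1}A$, and let $\psi(x)=[\psi_1(x_1)\,\cdots\,\psi_n(x_n)]^T$, where each $\psi_i:\mathbb{R}\to\mathbb{R}$ satisfies (A.1)–(A.4) below. Let $\lambda_{n-1}(H_1)$ be the second largest eigenvalue of $H_1$ (the eigenvalues of $H_1$ are real), and assume that it is simple and that $\lambda_{n-1}(H_1)>0$. Set $\pi_2=\frac{1}{\lambda_{n-1}(H_1)}$, so that $\pi_2>1$. For every $\pi>0$, the system $$\dot x=\Delta\left[-x+\pi H_1\psi(x)\right],\qquad x\in\mathbb{R}^n,$$ admits an equilibrium point $\bar x\in\mathcal{K}$, with $\mathcal{K}\neq\mathbb{R}^n_+,\mathbb{R}^n_-$ an orthant of $\mathbb{R}^n$ and $\bar x\notin\mathbb{R}^n_+\cup\mathbb{R}^n_-$, if and only if $\pi>\pi_2$.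
   Context: A matrix $A\in\mathbb{R}^{n\times n}$ is (diagonally) symmetrizable if $DA$ is symmetric for some diagonal matrix $D$ with positive diagonal entries; such a matrix has real eigenvalues. Here $H_1$ is symmetrizable, and its eigenvalues are arranged in nondecreasing order $\lambda_1(H_1)\le\dots\le\lambda_{n-1}(H_1)\le\lambda_n(H_1)=1$, counted with multiplicity. An irreducible matrix with null diagonal has $n\ge 2$ (the $1\times1$ zero matrix is reducible), so all $\delta_i>0$. Each $\psi_i$ is continuously differentiable and satisfies: (A.1) $\psi_i(-x_i)=-\psi_i(x_i)$ for all $x_i\in\mathbb{R}$; (A.2) $\frac{\partial\psi_i}{\partial x_i}(x_i)>0$ for all $x_i\in\mathbb{R}$ and $\frac{\partial\psi_i}{\partial x_i}(0)=1$; (A.3) $\lim_{x_i\to\pm\infty}\psi_i(x_i)=\pm1$; (A.4) $\psi_i$ is strictly convex for $x_i<0$ and strictly concave for $x_i>0$. An orthant is a set $\mathcal{K}=\{x\in\mathbb{R}^n: k_ix_i\ge0,\ i=1,\dots,n\}$ with $k_i\in\{\pm1\}$; $\mathbb{R}^n_+$ and $\mathbb{R}^n_-$ are the orthants with all $k_i=1$ and all $k_i=-1$, respectively. *)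

(* Defs.v *)
From mathcomp Require Import all_boot all_order all_fingroup all_algebra.
From mathcomp Require Import all_classical all_reals all_analysis.
From mathcomp Require Import complex.
From mathcomp Require polyrcf.

Set Implicit Arguments.
Unset Strict Implicit.
Unset Printing Implicit Defensive.

Import Order.TTheory GRing.Theory Num.Theory.
Import numFieldNormedType.Exports.

Local Open Scope classical_set_scope.
Local Open Scope ring_scope.

Definition nonneg_mx (R : realType) (n : nat) (A : 'M[R]_n) : Prop :=
  forall i j, 0 <= A i j.

Definition null_diag (R : realType) (n : nat) (A : 'M[R]_n) : Prop :=
  forall i, A i i = 0.

(* The block form [P^T A P = [B, C; 0, D]] with square diagonal blocks [B] and
   [D] of positive sizes [r] and [n - r], or the 1 x 1 zero matrix. *)
Definition reducible_mx (R : realType) (n : nat) (A : 'M[R]_n) : Prop :=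
  (n = 1%N /\ A = 0) \/
  (exists (s : 'S_n) (r : nat), (0 < r < n)%N /\
    forall i j : 'I_n, (r <= i)%N -> (j < r)%N ->
      row_perm s (col_perm s A) i j = 0).

Definition irreducible_mx (R : realType) (n : nat) (A : 'M[R]_n) : Prop :=
  ~ reducible_mx A.

Definition symmetrizable_mx (R : realType) (n : nat) (A : 'M[R]_n) : Prop :=
  exists d : 'rV[R]_n,
    (forall i, 0 < d 0 i) /\ diag_mx d *m A \is symmetricmx.

Definition Delta_mx (R : realType) (n : nat) (A : 'M[R]_n) : 'M[R]_n :=
  diag_mx (\row_i \sum_j A i j).

Definition H1_mx (R : realType) (n : nat) (A : 'M[R]_n) : 'M[R]_n :=
  invmx (Delta_mx A) *m A.

(* The real eigenvalues in nondecreasing order, each repeated according to its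
   multiplicity as a root of the characteristic polynomial. *)
Definition spectrum (R : realType) (n : nat) (M : 'M[R]_n) : seq R :=
  flatten [seq nseq (mup z (char_poly M)) z | z <- polyrcf.rootsR (char_poly M)].

(* The next three facts show that [spectrum M] lists all [n] eigenvalues of a
   symmetrizable [M], with multiplicity and in order. *)
Lemma symmetrizable_spectrum (R : realType) (n : nat) (M : 'M[R]_n) :
  symmetrizable_mx M ->
  char_poly M = \prod_(z <- spectrum M) ('X - z%:P).
Proof.
case=> d [d_gt0 /is_hermitianmxP]; rewrite expr0 scale1r map_mx_id // => symM.
pose C : numClosedFieldType := complex R.
pose toC : {rmorphism R -> C} := real_complex_def (Phant R).
have conjE (x : R) : Num.conj (toC x) = toC x.
  by apply/CrealP/complex_realP; exists x.
have mon := char_poly_monic M.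
have [r Er] := closed_field_poly_normal (char_poly (map_mx toC M)).
rewrite (monicP (char_poly_monic _)) scale1r in Er.
have r_real z : z \in r -> z \is Num.real.
  move=> zr; have : root (char_poly (map_mx toC M)) z by rewrite Er root_prod_XsubC.
  have -> : char_poly (map_mx toC M) = char_poly (map_mx toC M)^T.
    rewrite /char_poly -det_tr; congr (\det _); apply/matrixP=> i j.
    by rewrite !mxE eq_sym.
  rewrite -eigenvalue_root_char => /eigenvalueP[v Ev v0].
  pose D := map_mx toC (diag_mx d); pose S := map_mx toC (diag_mx d *m M).
  have trD : D^T = D by rewrite /D map_trmx tr_diag_mx.
  have trS : S^T = S by rewrite /S map_trmx -symM.
  have ES : v *m S = z *: (v *m D).
    by rewrite -trS /S map_mxM trmx_mul trD mulmxA Ev scalemxAl.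
  pose vs := (map_mx Num.conj v)^T.
  have a_real : (v *m S *m vs) 0 0 \is Num.real.
    apply/CrealP.
    have cS : map_mx Num.conj S = S by apply/matrixP=> i j; rewrite !mxE conjE.
    transitivity ((map_mx Num.conj (v *m S *m vs))^T 0 0); first by rewrite !mxE.
    rewrite !map_mxM !trmx_mul cS trS mulmxA; congr ((_ *m _ *m _) 0 0).
    apply/matrixP=> i j; rewrite /vs !mxE.
    exact: conjCK.
  have Db : (v *m D *m vs) 0 0 = \sum_i toC (d 0 i) * `|v 0 i| ^+ 2.
    rewrite mxE; apply: eq_bigr => i _; rewrite /D map_diag_mx mul_mx_diag !mxE.
    by rewrite normCK -mulrA mulrCA.
  have dC i : 0 < toC (d 0 i).
    by rewrite -(rmorph0 toC) ltcR.
  have b_gt0 : 0 < (v *m D *m vs) 0 0.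
    rewrite Db lt_def sumr_ge0 ?andbT; last first.
      by move=> i _; rewrite mulr_ge0 ?(ltW (dC i)) ?exprn_ge0.
    apply: contra v0; rewrite psumr_eq0; last first.
      by move=> i _; rewrite mulr_ge0 ?(ltW (dC i)) ?exprn_ge0.
    move=> /allP h; apply/eqP/rowP=> i; rewrite mxE; apply/eqP.
    have := h i (mem_index_enum _).
    by rewrite mulf_eq0 (gt_eqF (dC i)) /= expf_eq0 normr_eq0.
  move: a_real; rewrite ES -scalemxAl mxE => a_real.
  have -> : z = z * (v *m D *m vs) 0 0 / (v *m D *m vs) 0 0.
    by rewrite mulfK // gt_eqF.
  by rewrite rpred_div // gtr0_real.
pose s : seq R := map (@complex.Re R) r.
have Es : char_poly M = \prod_(z <- s) ('X - z%:P).
  apply: (map_poly_inj toC); rewrite map_char_poly Er rmorph_prod big_map.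
  apply: eq_big_seq => z zr; rewrite rmorphB /= map_polyX map_polyC /=.
  congr ('X - _%:P); exact/esym/RRe_real/r_real.
have p0 : char_poly M != 0 by apply: monic_neq0.
rewrite Es; apply: perm_big; apply/allP => z _; apply/eqP.
rewrite -mu_prod_XsubC -Es /spectrum.
have U : uniq (polyrcf.rootsR (char_poly M)) by exact: polyrcf.uniq_roots.
have Hr : root (char_poly M) z = (z \in polyrcf.rootsR (char_poly M)).
  by rewrite -polyrcf.roots_on_rootsR // in_itv.
transitivity ((z \in polyrcf.rootsR (char_poly M)) * mup z (char_poly M))%N.
  by rewrite -Hr; case: (boolP (root _ _)) => [_|/mupNroot->]; rewrite ?mul1n.
elim: (polyrcf.rootsR _) U => [|y t IH] //= /andP[yt U].
rewrite count_cat -IH // count_nseq /= in_cons eq_sym.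
by case: eqVneq yt => //= <- /negPf->; rewrite mul0n addn0.
Qed.

Lemma size_spectrum (R : realType) (n : nat) (M : 'M[R]_n) :
  symmetrizable_mx M -> size (spectrum M) = n.
Proof.
move=> /symmetrizable_spectrum E; apply: succn_inj.
by rewrite -(size_prod_XsubC _ id) -E size_char_poly.
Qed.

Lemma sorted_spectrum (R : realType) (n : nat) (M : 'M[R]_n) :
  sorted <=%R (spectrum M).
Proof.
have : sorted <%R (polyrcf.rootsR (char_poly M)) by exact: polyrcf.sorted_roots.
rewrite /spectrum (sorted_pairwise lt_trans) (sorted_pairwise le_trans).
elim: (polyrcf.rootsR _) => //= y t IH /andP[/allP yt /IH{}IH].
rewrite pairwise_cat IH andbT; apply/andP; split.
  apply/allrelP=> a b; rewrite mem_nseq => /andP[_ /eqP->] /flatten_mapP[c ct].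
  by rewrite mem_nseq => /andP[_ /eqP->]; rewrite ltW ?yt.
by elim: (mup _ _) => //= m ->; rewrite andbT all_nseq lexx orbT.
Qed.

(* Indexed from 1 as in [lambda_1 <= ... <= lambda_n]. *)
Definition eigval (R : realType) (n : nat) (M : 'M[R]_n) (k : nat) : R :=
  (spectrum M)`_k.-1.

Definition strictly_convex_on (R : realType) (D : set R) (f : R -> R) : Prop :=
  forall x y t : R, D x -> D y -> x != y -> 0 < t -> t < 1 ->
    f (t * x + (1 - t) * y) < t * f x + (1 - t) * f y.

Definition strictly_concave_on (R : realType) (D : set R) (f : R -> R) : Prop :=
  strictly_convex_on D (fun x => - f x).

Definition C1 (R : realType) (f : R -> R) : Prop :=
  (forall x : R, derivable f x 1) /\ continuous f^`()%classic.

Record sigmoidal (R : realType) (f : R -> R) : Prop := Sigmoidal {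
  sigmoidal_C1 : C1 f;
  sigmoidal_odd : forall x : R, f (- x) = - f x;
  sigmoidal_deriv_gt0 : forall x : R, 0 < f^`()%classic x;
  sigmoidal_deriv0 : f^`()%classic 0 = 1;
  sigmoidal_cvg_pinfty : f x @[x --> +oo] --> (1 : R);
  sigmoidal_cvg_ninfty : f x @[x --> -oo] --> (- 1 : R);
  sigmoidal_convex : strictly_convex_on [set x : R | x < 0] f;
  sigmoidal_concave : strictly_concave_on [set x : R | 0 < x] f
}.

Definition psi_vec (R : realType) (n : nat) (psi : 'I_n -> R -> R)
  (x : 'cV[R]_n) : 'cV[R]_n := \col_i psi i (x i 0).

Definition vfield (R : realType) (n : nat) (A : 'M[R]_n) (psi : 'I_n -> R -> R)
  (p : R) (x : 'cV[R]_n) : 'cV[R]_n :=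
  Delta_mx A *m (- x + p *: (H1_mx A *m psi_vec psi x)).

(* Equilibrium point of the autonomous system [x' = f x]. *)
Definition equilibrium (R : realType) (n : nat) (f : 'cV[R]_n -> 'cV[R]_n)
  (x : 'cV[R]_n) : Prop := f x = 0.

Definition orthant (R : realType) (n : nat) (k : 'I_n -> R) : set 'cV[R]_n :=
  [set x | forall i, 0 <= k i * x i 0].

Definition is_orthant (R : realType) (n : nat) (K : set 'cV[R]_n) : Prop :=
  exists k : 'I_n -> R, (forall i, k i = 1 \/ k i = - 1) /\ K = orthant k.

Definition pos_orthant (R : realType) (n : nat) : set 'cV[R]_n :=
  orthant (fun=> 1).
Arguments pos_orthant : clear implicits.

Definition neg_orthant (R : realType) (n : nat) : set 'cV[R]_n :=
  orthant (fun=> - 1).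
Arguments neg_orthant : clear implicits.

(* Main.v *)
(** Write D for the symmetrizer, [w = D A] and [m_i = \sum_j w_ij].  Equilibria
    are the solutions of [m_i x_i = p \sum_j w_ij psi_j(x_j)], and the eigenvalues
    of [H1] are those of the pencil [(w, diag m)].

    Necessity.  Let x be a sign-changing equilibrium and [y = psi(x)].  Rescaling
    the positive and the negative part of y independently gives a plane on which
    [p u^T w u > \sum_i m_i u_i^2], because [|y_i| < |x_i|] and because the cross
    terms between the two parts have the good sign.  This plane contains a vector
    orthogonal to the Perron vector 1, so the Rayleigh principle yields an
    eigenvalue [l < 1] with [p l > 1].

    Sufficiency.  The map [x |-> p / (1 + p) (x + H1 psi(x))] preserves the box
    [|x_i| <= p] and the interiors of the two orthants, and strictly decreases an
    energy E off its fixed points, which are the equilibria.  Let C be the compact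
    set of points whose orbit never enters these interiors.  E attains its minimum
    on C at a fixed point.  A small half circle in the plane spanned by 1 and the
    second eigenvector joins the two orthants, so by connectedness it meets C; since
    [p lambda_{n-1} > 1], E is negative on it.  The minimizer is therefore nonzero,
    and irreducibility keeps it away from the boundary of the two orthants. *)
Require Import Defs.
From mathcomp Require Import all_boot all_order all_fingroup all_algebra.
From mathcomp Require Import all_classical all_reals all_analysis.
From mathcomp Require Import ring lra zify.

Set Implicit Arguments.
Unset Strict Implicit.
Unset Printing Implicit Defensive.

Import Order.TTheory GRing.Theory Num.Theory.
Import numFieldNormedType.Exports.

Local Open Scope classical_set_scope.
Local Open Scope ring_scope.

(** * Sigmoidal functions *)

(** Allowing [a] and [b] in either order treats both signs of [x] at once in the expansions at 0.
    Derivatives are asked only to the right of [l] because the antiderivatives are integrals from a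
    finite base point. *)
Lemma MVT_unordered (R : realType) (g dg : R -> R) (l a b : R) :
    (forall x, l < x -> is_derive x (1 : R) g (dg x)) -> l < a -> l < b ->
  exists c, [/\ (a <= c <= b) || (b <= c <= a) & g b - g a = dg c * (b - a)].
Proof.
move=> D la lb.
have main u v : l < u -> u <= v ->
    exists c, u <= c <= v /\ g v - g u = dg c * (v - u).
  move=> lu uv.
  have Duv x : u <= x -> is_derive x (1 : R) g (dg x).
    by move=> ux; apply: D; lra.
  have [//|x|x|c] := @MVT_segment R g dg u v.
  - by rewrite in_itv /= => /andP[/ltW/Duv].
  - apply: continuous_in_subspaceT => {}x; rewrite inE /= in_itv /= => /andP[ux _].
    apply/differentiable_continuous/derivable1_diffP.
    by have [] := Duv _ ux.
  - by rewrite in_itv /=; exists c.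
have [ab|ba] := leP a b.
  by have [c [cab E]] := main _ _ la ab; exists c; rewrite cab.
have [c [cba E]] := main _ _ lb (ltW ba); exists c; rewrite cba orbT; split=> //.
lra.
Qed.

Lemma continuous_antiderivative (R : realType) (f : R -> R) (l : R) :
  continuous f -> exists F : R -> R, forall x, l < x -> is_derive x (1 : R) F (f x).
Proof.
move=> cf; 
pose F x := (\int[lebesgue_measure]_(t in `[l, x]) f t)%R.
exists F => x lx.
have xx1 : x < x + 1 by rewrite ltrDl.
have int : lebesgue_measure.-integrable `[l, x + 1] (EFin \o f).
  apply: continuous_compact_integrable; first exact: segment_compact.
  exact: continuous_subspaceT.
have : derivable F x 1 /\ F^`()%classic x = f x.
  exact: continuous_FTC1_closed xx1 int lx (cf x).
move: F => F [D E]; apply: DeriveDef; first exact: D.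
by rewrite -derive1E E.
Qed.

Section Sigmoid.
Variables (R : realType) (f : R -> R).
Hypothesis sf : sigmoidal f.

Lemma sigmoidal_is_derive x : is_derive x (1 : R) f (f^`()%classic x).
Proof.
by rewrite derive1E; apply: DeriveDef => //; exact: (sigmoidal_C1 sf).1.
Qed.

Lemma sigmoidal_continuous : continuous f.
Proof.
move=> x; apply/differentiable_continuous/derivable1_diffP.
exact: (sigmoidal_C1 sf).1.
Qed.

Lemma sigmoidal0 : f 0 = 0.
Proof. by have := sigmoidal_odd sf 0; rewrite oppr0; lra. Qed.

Lemma sigmoidal_mono : {mono f : x y / x <= y}.
Proof.
apply: le_mono => x y xy.
have [c _ E] := MVT xy (fun z _ => sigmoidal_is_derive z)
  (continuous_subspaceT sigmoidal_continuous).
by rewrite -subr_gt0 E mulr_gt0 ?subr_gt0 ?(sigmoidal_deriv_gt0 sf).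
Qed.

Lemma sigmoidal_mono_lt : {mono f : x y / x < y}.
Proof. exact: leW_mono sigmoidal_mono. Qed.

Lemma sigmoidal_norm_le1 x : `|f x| <= 1.
Proof.
have H y : f y <= 1.
  have <- : lim (f z @[z --> +oo]) = 1.
    by apply: cvg_lim => //; exact: sigmoidal_cvg_pinfty.
  apply: limr_ge; first by apply/cvg_ex; exists 1; exact: sigmoidal_cvg_pinfty.
  by near=> z; rewrite sigmoidal_mono.
by rewrite ler_norml H andbT lerNl -(sigmoidal_odd sf) H.
Unshelve. all: by end_near. Qed.

Lemma sigmoidal_near0 e : 0 < e ->
  exists2 r, 0 < r & forall x, `|x| <= r -> `|f x - x| <= e * `|x|.
Proof.
move=> e0; have /cvgrPdist_le/(_ _ e0) := (sigmoidal_C1 sf).2 0.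
rewrite (sigmoidal_deriv0 sf) => /nbhs_ballP[r /= r0 Hr].
exists (r / 2) => [|x xr]; first by rewrite divr_gt0.
(* The base point is any number to the left of both 0 and [x]. *)
have [||c [cx]] := @MVT_unordered R f _ (- `|x| - 1) 0 x
    (fun z _ => sigmoidal_is_derive z).
- by have := normr_ge0 x; lra.
- by have := ler_norm (- x); rewrite normrN; lra.
rewrite sigmoidal0 !subr0 => E.
have -> : f x - x = (f^`()%classic c - 1) * x by rewrite E; ring.
rewrite normrM ler_wpM2r // distrC; apply: Hr.
rewrite /ball /= sub0r normrN (@le_lt_trans _ _ `|x|) //; last by lra.
by case/orP: cx => /andP[c1 c2];
  [rewrite !ger0_norm //; lra|rewrite !ler0_norm //; lra].
Qed.

(** Strict concavity as a comparison of chord slopes without denominators: [v] is the convex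
    combination of [u] and [w] with weight [(w - v) / (w - u)] on [u]. *)
Lemma sigmoidal_slope (u v w : R) : 0 < u -> u < v -> v < w ->
  (f w - f v) * (v - u) < (f v - f u) * (w - v).
Proof.
move=> u0 uv vw; have wu : 0 < w - u by lra.
have t0 : 0 < (w - v) / (w - u) by apply: divr_gt0; lra.
have t1 : (w - v) / (w - u) < 1 by rewrite ltr_pdivrMr // ; lra.
have uw : u != w by rewrite lt_eqF //; lra.
have w0 : 0 < w by lra.
have := sigmoidal_concave sf u0 w0 uw t0 t1.
rewrite /=.
have -> : (w - v) / (w - u) * u + (1 - (w - v) / (w - u)) * w = v.
  by field; lra.
have -> : (w - v) / (w - u) * - f u + (1 - (w - v) / (w - u)) * - f w =
  - ((w - v) * f u + (v - u) * f w) / (w - u).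
  by field; lra.
rewrite ltr_pdivlMr //; nra.
Qed.

(** Concavity is given on the open half line, so the chord from 0 is reached through chords from
    small [e > 0], at the price of strictness. *)
Lemma sigmoidal_slope0 (u v : R) : 0 < u -> u < v ->
  (f v - f u) * u <= f u * (v - u).
Proof.
move=> u0 uv; rewrite leNgt; apply/negP => H.
have fu0 : 0 < f u by rewrite -sigmoidal0 sigmoidal_mono_lt.
have fuv : f u < f v by rewrite sigmoidal_mono_lt.
set K := f v - f u in H; have K0 : 0 < K by rewrite subr_gt0.
(* Moving the left endpoint from 0 to [e] costs [K * e], which is half of the assumed violation. *)
set e := ((K * u) - f u * (v - u)) / (2 * K).
have Ee : 2 * (K * e) = K * u - f u * (v - u) by rewrite /e; field; lra.
have e0 : 0 < e by rewrite divr_gt0 ?mulr_gt0 // subr_gt0.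
have eu : e < u by have : 0 < f u * (v - u) by [nra]; nra.
have := sigmoidal_slope e0 eu uv; rewrite -/K.
have fe0 : 0 < f e by rewrite -sigmoidal0 sigmoidal_mono_lt.
by nra.
Qed.

(** Slopes of chords from 0 decrease, and close to 0 they are at most [1 + e / x] because the
    derivative there is 1. *)
Lemma sigmoidal_le_id (x : R) : 0 <= x -> f x <= x.
Proof.
rewrite le_eqVlt => /predU1P[<-|x0]; first by rewrite sigmoidal0.
apply/ler_addgt0Pr => e e0.
have ex0 : 0 < e / x by rewrite divr_gt0.
have [r r0 Hr] := sigmoidal_near0 ex0.
pose u := Num.min r (x / 2).
have u0 : 0 < u by rewrite lt_min r0 divr_gt0.
have ur : u <= r by rewrite ge_min lexx.
have ux : u <= x / 2 by rewrite ge_min lexx orbT.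
have {}Hr : f u <= u + e / x * u.
  by have := Hr u; rewrite gtr0_norm // => /(_ ur); rewrite ler_norml; lra.
have ux' : u < x by lra.
have S := sigmoidal_slope0 u0 ux'.
have {}S : f x * u <= (x + e) * u.
  have -> : (x + e) * u = (u + e / x * u) * x by field; lra.
  by nra.
by rewrite -(ler_pM2r u0).
Qed.

(** Strict concavity at [x / 4], [x / 2] and [x] gives [f x < 2 * f (x / 2)], and the right side is
    at most [x]. *)
Lemma sigmoidal_lt_id (x : R) : 0 < x -> f x < x.
Proof.
move=> x0; have q0 : 0 < x / 4 by lra.
have qh : x / 4 < x / 2 by lra.
have hx : x / 2 < x by lra.
have := sigmoidal_slope q0 qh hx; have := sigmoidal_slope0 q0 qh.
have := @sigmoidal_le_id (x / 2); nra.
Qed.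

(** To the right of [u > 0] chord slopes are at most [f u / u <= 1]. Oddness mirrors this bound, and
    an interval around 0 is split there. *)
Lemma sigmoidal_lipschitz (a b : R) : a <= b -> f b - f a <= b - a.
Proof.
have pos u v : 0 <= u -> u <= v -> f v - f u <= v - u.
  rewrite le_eqVlt => /predU1P[<-|u0] uv.
    by rewrite sigmoidal0 !subr0 sigmoidal_le_id.
  move: uv; rewrite le_eqVlt => /predU1P[->|uv]; first by rewrite !subrr.
  have := sigmoidal_slope0 u0 uv; have := sigmoidal_le_id (ltW u0).
  by move=> h1 h2; rewrite -(ler_pM2r u0); nra.
move=> ab; have [a0|a0] := leP 0 a; first exact: pos.
have [b0|b0] := leP b 0.
  have := pos (- b) (- a); rewrite !(sigmoidal_odd sf); lra.
have := pos 0 b; have := pos 0 (- a); rewrite (sigmoidal_odd sf) sigmoidal0; lra.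
Qed.

(** Co-coercivity of an increasing 1-Lipschitz map, the source of the energy decrease below. *)
Lemma sigmoidal_contraction (a b : R) :
  (f b - f a) ^+ 2 <= (b - a) * (f b - f a).
Proof.
have [ab|ba] := leP a b.
  have := sigmoidal_lipschitz ab; have : f a <= f b by rewrite sigmoidal_mono.
  by nra.
have := sigmoidal_lipschitz (ltW ba).
have : f b <= f a by rewrite sigmoidal_mono ltW.
by nra.
Qed.

Section Antiderivative.
Variables (l : R) (F : R -> R).
Hypothesis F_derive : forall x, l < x -> is_derive x (1 : R) F (f x).

Lemma sigmoidal_antiderivative_convex (x y : R) : l < x -> l < y ->
  F x + f x * (y - x) <= F y.
Proof.
move=> lx ly; have [c [cxy E]] := MVT_unordered F_derive lx ly.
suff : f x * (y - x) <= f c * (y - x) by lra.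
case/orP: cxy => /andP[h1 h2].
  by rewrite ler_wpM2r ?subr_ge0 ?sigmoidal_mono //; lra.
by rewrite ler_wnM2r ?subr_le0 ?sigmoidal_mono //; lra.
Qed.

(** Subtracting [(1 - e) / 2 * z ^+ 2] from [F] leaves a function whose derivative near 0 is
    nonnegative for [z >= 0] and nonpositive for [z <= 0]. *)
Lemma sigmoidal_antiderivative_ge (e r x : R) : l < 0 -> l < x ->
    (forall z, `|z| <= r -> `|f z - z| <= e * `|z|) -> `|x| <= r ->
  (1 - e) * x ^+ 2 / 2 <= F x - F 0.
Proof.
move=> l0 lx Hr xr.
pose G z := F z - (1 - e) / 2 * z ^+ 2.
have GD z : l < z -> is_derive z (1 : R) G (f z - (1 - e) * z).
  move=> lz; have := F_derive lz => Fz.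
  have -> : f z - (1 - e) * z = f z - (1 - e) / 2 *: (2 *: z).
    by rewrite /GRing.scale /=; field.
  apply: is_deriveB; apply: is_deriveZ.
  apply: DeriveDef; first exact: exprn_derivable.
  by rewrite exp_derive /= expr1 [_ *: 1]mulr1.
have [c [cx]] := MVT_unordered GD l0 lx.
rewrite /G => E.
suff : 0 <= (f c - (1 - e) * c) * (x - 0) by rewrite -E; lra.
rewrite subr0; case/orP: cx => /andP[c1 c2].
  have := Hr c; rewrite ger0_norm // => h; have := h _.
  have cr : c <= r by move: xr; rewrite ger0_norm; lra.
  by move=> /(_ cr); rewrite ler_norml => /andP[? ?]; rewrite mulr_ge0; lra.
have := Hr c; rewrite ler0_norm // => h; have := h _.
have cr : - c <= r by move: xr; rewrite ler0_norm; lra.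
by move=> /(_ cr); rewrite ler_norml => /andP[? ?]; rewrite mulr_le0; lra.
Qed.

End Antiderivative.
End Sigmoid.

(** * Quadratic forms of weighted graphs *)

Section WeightedGraph.
Variables (R : realFieldType) (n : nat) (w : 'I_n -> 'I_n -> R).
Implicit Types u v x y c f : 'I_n -> R.

Definition mass i := \sum_j w i j.
Definition wsum f := \sum_i mass i * f i.
(** The quotient of [wform u u] by [wsum (fun i => u i ^+ 2)] is the Rayleigh quotient of the pencil
    formed by [w] and the diagonal matrix of [mass]. *)
Definition wform u v := \sum_i \sum_j w i j * (u i * v j).

Hypothesis w_ge0 : forall i j, 0 <= w i j.
Hypothesis w_sym : forall i j, w i j = w j i.
Hypothesis w_conn : forall P : pred 'I_n, (exists i, P i) ->
  (forall i j, P i -> 0 < w i j -> P j) -> forall i, P i.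
Hypothesis mass_gt0 : forall i, 0 < mass i.

Lemma eq_wsum f g : f =1 g -> wsum f = wsum g.
Proof. by move=> fg; apply: eq_bigr => i _; rewrite fg. Qed.

Lemma wsum_double f : wsum f = \sum_i \sum_j w i j * f i.
Proof. by apply: eq_bigr => i _; rewrite mulr_suml. Qed.

Lemma wsum_double_sym f : wsum f = \sum_i \sum_j w i j * f j.
Proof.
rewrite exchange_big /= wsum_double; apply: eq_bigr => i _.
by apply: eq_bigr => j _; rewrite w_sym.
Qed.

Lemma wsumD f g : wsum (fun i => f i + g i) = wsum f + wsum g.
Proof. by rewrite -big_split; apply: eq_bigr => i _; rewrite mulrDr. Qed.

Lemma wsumZ a f : wsum (fun i => a * f i) = a * wsum f.
Proof. by rewrite mulr_sumr; apply: eq_bigr => i _; rewrite mulrCA. Qed.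

Lemma ler_wsum f g : (forall i, f i <= g i) -> wsum f <= wsum g.
Proof. by move=> fg; apply: ler_sum => i _; rewrite ler_wpM2l ?fg // ltW. Qed.

Lemma ltr_wsum f g k : (forall i, f i <= g i) -> f k < g k -> wsum f < wsum g.
Proof.
move=> fg fgk; rewrite /wsum (bigD1 k) //= [ltRHS](bigD1 k) //=.
by rewrite ltr_leD ?ltr_pM2l // ler_sum // => i _; rewrite ler_wpM2l ?fg // ltW.
Qed.

Lemma wsum_sqr_ge0 u : 0 <= wsum (fun i => u i ^+ 2).
Proof. by apply: sumr_ge0 => i _; rewrite mulr_ge0 ?sqr_ge0 // ltW. Qed.

Lemma wsum_sqr_eq0 u : wsum (fun i => u i ^+ 2) = 0 -> forall i, u i = 0.
Proof.
move=> /eqP; rewrite psumr_eq0 => [/allP H i|i _]; last first.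
  by rewrite mulr_ge0 ?sqr_ge0 // ltW.
have := H i (mem_index_enum _); rewrite /= mulf_eq0 gt_eqF //= sqrf_eq0.
by move/eqP.
Qed.

Lemma wsum_sqr_gt0 u i : u i != 0 -> 0 < wsum (fun i => u i ^+ 2).
Proof.
move=> ui; rewrite lt_def wsum_sqr_ge0 andbT.
by apply: contra ui => /eqP/wsum_sqr_eq0 ->.
Qed.

Lemma wformE u v : wform u v = \sum_i u i * \sum_j w i j * v j.
Proof.
apply: eq_bigr => i _; rewrite mulr_sumr; apply: eq_bigr => j _; ring.
Qed.

Lemma wformC u v : wform u v = wform v u.
Proof.
rewrite /wform exchange_big; apply: eq_bigr => i _; apply: eq_bigr => j _.
by rewrite w_sym [u j * _]mulrC.
Qed.

Lemma wformDr u v y : wform u (fun i => v i + y i) = wform u v + wform u y.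
Proof.
rewrite -big_split; apply: eq_bigr => i _; rewrite -big_split.
by apply: eq_bigr => j _ /=; ring.
Qed.

Lemma wformZr a u v : wform u (fun i => a * v i) = a * wform u v.
Proof.
rewrite mulr_sumr; apply: eq_bigr => i _; rewrite mulr_sumr.
by apply: eq_bigr => j _ /=; ring.
Qed.

Lemma wform_sqrD u v : wform (fun i => u i + v i) (fun i => u i + v i) =
  wform u u + 2 * wform u v + wform v v.
Proof.
rewrite wformDr ![wform (fun i => _ + _) _]wformC !wformDr (wformC v u); ring.
Qed.

Lemma eq_wform u v u' v' : u =1 u' -> v =1 v' -> wform u v = wform u' v'.
Proof.
move=> uu vv; apply: eq_bigr => i _; apply: eq_bigr => j _.
by rewrite uu vv.
Qed.

Lemma wform_sqrDZ a b u v : 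
  wform (fun i => a * u i + b * v i) (fun i => a * u i + b * v i) =
  a ^+ 2 * wform u u + 2 * (a * b) * wform u v + b ^+ 2 * wform v v.
Proof.
rewrite wform_sqrD !wformZr ![wform (fun i => _ * _) _]wformC !wformZr.
rewrite (wformC v u); ring.
Qed.

Lemma wsum_sqrDZ a b u v : wsum (fun i => (a * u i + b * v i) ^+ 2) =
  a ^+ 2 * wsum (fun i => u i ^+ 2) + 2 * (a * b) * wsum (fun i => u i * v i) +
  b ^+ 2 * wsum (fun i => v i ^+ 2).
Proof. by rewrite -!wsumZ -!wsumD; apply: eq_wsum => i; ring. Qed.

(** The Dirichlet form of the graph: by symmetry [wsum] can be written once with [u i] and once with
    [u j], which completes the squares. *)
Lemma wform_dirichlet u : wsum (fun i => u i ^+ 2) - wform u u =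
  2^-1 * \sum_i \sum_j w i j * (u i - u j) ^+ 2.
Proof.
have -> : \sum_i \sum_j w i j * (u i - u j) ^+ 2 =
    wsum (fun i => u i ^+ 2) + wsum (fun i => u i ^+ 2) - 2 * wform u u.
  rewrite {1}wsum_double wsum_double_sym -big_split /wform mulr_sumr -sumrB /=.
  apply: eq_bigr => i _; rewrite mulr_sumr -big_split -sumrB /=.
  by apply: eq_bigr => j _; ring.
by field.
Qed.

Lemma wform_le_wsum u : wform u u <= wsum (fun i => u i ^+ 2).
Proof.
rewrite -subr_ge0 wform_dirichlet mulr_ge0 ?invr_ge0 //.
by apply: sumr_ge0 => i _; apply: sumr_ge0 => j _; rewrite mulr_ge0 ?sqr_ge0.
Qed.

(** Passing to absolute values also controls negative eigenvalues: the pencil has its spectrum in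
    [-1, 1]. *)
Lemma wform_abs_le_wsum u : `|wform u u| <= wsum (fun i => u i ^+ 2).
Proof.
have H : `|wform u u| <= wform (fun i => `|u i|) (fun i => `|u i|).
  apply: le_trans (ler_norm_sum _ _ _) _; apply: ler_sum => i _.
  apply: le_trans (ler_norm_sum _ _ _) _; apply: ler_sum => j _.
  by rewrite !normrM ger0_norm.
apply: le_trans H (le_trans (wform_le_wsum _) _).
by rewrite (@eq_wsum _ (fun i => u i ^+ 2)) // => i; rewrite real_normK ?num_real.
Qed.

(** Equality kills every edge term of the Dirichlet form, so [u] agrees across edges and
    connectivity spreads its value. *)
Lemma wform_eq_wsum_const u :
  wform u u = wsum (fun i => u i ^+ 2) -> forall i j, u i = u j.
Proof.
move=> E i0 j0; apply/esym/eqP; move: j0.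
apply: w_conn; first by exists i0.
move=> i j /eqP <- wij; apply/eqP.
have /eqP := wform_dirichlet u; rewrite E subrr eq_sym mulf_eq0 invr_eq0.
rewrite (gt_eqF (ltr0n _ 2)) /= psumr_eq0 => [/allP H|k _]; last first.
  by apply: sumr_ge0 => l _; rewrite mulr_ge0 ?sqr_ge0.
have := H i (mem_index_enum _); rewrite psumr_eq0 /= => [/allP {}H|l _]; last first.
  by rewrite mulr_ge0 ?sqr_ge0.
have := H j (mem_index_enum _); rewrite /= mulf_eq0 (gt_eqF wij) /= sqrf_eq0.
by rewrite subr_eq0 => /eqP.
Qed.

(** * Nodal domains of a sign-changing equilibrium *)

Section Equilibrium.
Variables (p : R) (x y : 'I_n -> R).
Hypothesis p_gt0 : 0 < p.
Hypothesis equil : forall i, mass i * x i = p * \sum_j w i j * y j.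
Hypothesis xy : forall i, y i != 0 -> y i ^+ 2 < x i * y i.

(* The cross terms between the nodal domains of y have the good sign, because
   [y i * y j < 0] there. *)
Lemma nodal_lt c k : (forall i j, 0 < y i * y j -> c i = c j) -> c k * y k != 0 ->
  wsum (fun i => (c i * y i) ^+ 2) <
  p * wform (fun i => c i * y i) (fun i => c i * y i).
Proof.
move=> cc ck; apply: (@lt_le_trans _ _ (wsum (fun i => c i ^+ 2 * (x i * y i)))).
  have xy' i : y i ^+ 2 <= x i * y i.
    by have [->|/xy/ltW //] := eqVneq (y i) 0; rewrite expr0n mulr0.
  apply: (@ltr_wsum _ _ k) => [i|]; first by rewrite exprMn ler_wpM2l ?sqr_ge0.
  move: ck; rewrite mulf_eq0 negb_or => /andP[c0 /xy yk].
  by rewrite exprMn ltr_pM2l // exprn_even_gt0.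
have -> : wsum (fun i => c i ^+ 2 * (x i * y i)) =
    p * \sum_i \sum_j w i j * (c i ^+ 2 * (y i * y j)).
  rewrite mulr_sumr; apply: eq_bigr => i _.
  transitivity (c i ^+ 2 * y i * (mass i * x i)); first by ring.
  rewrite equil mulrCA; congr (_ * _); rewrite mulr_sumr.
  by apply: eq_bigr => j _; ring.
rewrite ler_pM2l // -subr_ge0.
suff -> : wform (fun i => c i * y i) (fun i => c i * y i) -
    \sum_i \sum_j w i j * (c i ^+ 2 * (y i * y j)) =
    2^-1 * \sum_i \sum_j w i j * ((c i - c j) ^+ 2 * - (y i * y j)).
  rewrite mulr_ge0 ?invr_ge0 //.
  apply: sumr_ge0 => i _; apply: sumr_ge0 => j _; rewrite mulr_ge0 //.
  have [yy|yy] := ltP 0 (y i * y j); first by rewrite (cc _ _ yy) subrr expr0n mul0r.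
  by rewrite mulr_ge0 ?sqr_ge0 ?oppr_ge0.
set S := \sum_i \sum_j w i j * (c i ^+ 2 * (y i * y j)).
have ES : S = \sum_i \sum_j w i j * (c j ^+ 2 * (y i * y j)).
  rewrite /S exchange_big; apply: eq_bigr => i _; apply: eq_bigr => j _.
  by rewrite w_sym [y j * _]mulrC.
have -> : \sum_i \sum_j w i j * ((c i - c j) ^+ 2 * - (y i * y j)) =
    2 * wform (fun i => c i * y i) (fun i => c i * y i) - S - S.
  rewrite {2}ES mulr_sumr -!sumrB; apply: eq_bigr => i _.
  by rewrite mulr_sumr -!sumrB; apply: eq_bigr => j _; ring.
by field.
Qed.

Lemma sign_changing_test_vector : (exists i, 0 < y i) -> (exists i, y i < 0) ->
  exists u, wsum u = 0 /\ wsum (fun i => u i ^+ 2) < p * wform u u.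
Proof.
move=> [i i0] [j j0].
(* [a] and [b] are the weights of the negative and positive parts of [y]. Scaling the positive part
   by [a] and the negative one by [b] balances [wsum]. *)
pose a := wsum (fun k => if y k < 0 then - y k else 0).
pose b := wsum (fun k => if 0 < y k then y k else 0).
have wsum0 : wsum (fun=> 0) = 0 by rewrite /wsum big1 // => k _; rewrite mulr0.
have a0 : 0 < a.
  rewrite -wsum0; apply: (@ltr_wsum _ _ j) => [k|]; last by rewrite j0 oppr_gt0.
  by case: ifP => // /ltW; rewrite oppr_ge0.
have b0 : 0 < b.
  rewrite -wsum0; apply: (@ltr_wsum _ _ i) => [k|]; last by rewrite i0.
  by case: ifP => // /ltW.
pose c k := if 0 < y k then a else b.
exists (fun k => c k * y k); split; last first.
  apply: (@nodal_lt _ i) => [k l|]; last by rewrite /c i0 mulf_neq0 ?gt_eqF.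
  rewrite /c; case: (ltgtP (y k) 0) => [k0|k0|->]; last by rewrite mul0r ltxx.
  - by rewrite nmulr_rgt0 // => l0; rewrite ltNge ltW.
  - by rewrite pmulr_rgt0 // => ->.
have -> : wsum (fun k => c k * y k) =
    wsum (fun k => a * (if 0 < y k then y k else 0) +
      - b * (if y k < 0 then - y k else 0)).
  by apply: eq_wsum => k; rewrite /c; case: (ltgtP (y k) 0) => [_|_|->]; ring.
by rewrite wsumD !wsumZ -/a -/b mulNr mulrC subrr.
Qed.

End Equilibrium.
End WeightedGraph.

(** * Rayleigh principle orthogonally to the constants *)

Lemma linear_coef_eq0 (R : realFieldType) (a b : R) :
  (forall t, a * t ^+ 2 + 2 * b * t <= 0) -> b = 0.
Proof.
move=> H; apply/eqP; rewrite -sqrf_eq0 eq_le sqr_ge0 andbT.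
have d0 : 0 < 1 + `|a| by have := normr_ge0 a; lra.
(* For this [t] the linear term outweighs the quadratic one, whatever the sign of [a]. *)
have := H (b / (1 + `|a|)).
have -> : a * (b / (1 + `|a|)) ^+ 2 + 2 * b * (b / (1 + `|a|)) =
  b ^+ 2 * (a + 2 * (1 + `|a|)) / (1 + `|a|) ^+ 2 by field; lra.
rewrite pmulr_lle0 ?invr_gt0 ?exprn_gt0 // pmulr_lle0 //.
by have := ler_norm (- a); rewrite normrN; have := normr_ge0 a; lra.
Qed.

Section Rayleigh.
Variables (R : realType) (n : nat) (w : 'I_n -> 'I_n -> R).

Hypothesis w_sym : forall i j, w i j = w j i.
Hypothesis mass_gt0 : forall i, 0 < mass w i.

Lemma continuous_wsum (T : topologicalType) (f : 'I_n -> T -> R) (v : T) :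
  (forall i, continuous_at v (f i)) ->
  continuous_at v (fun t => wsum w (f^~ t)).
Proof.
move=> cf; rewrite /wsum; apply: cvg_big => [|i _]; first exact: add_continuous.
by apply: cvgM; [exact: cvg_cst|exact: cf].
Qed.

Lemma continuous_wform (T : topologicalType) (f g : 'I_n -> T -> R) (v : T) :
  (forall i, continuous_at v (f i)) -> (forall i, continuous_at v (g i)) ->
  continuous_at v (fun t => wform w (f^~ t) (g^~ t)).
Proof.
move=> cf cg; rewrite /wform; apply: cvg_big => [|i _]; first exact: add_continuous.
apply: cvg_big => [|j _]; first exact: add_continuous.
by apply: cvgM; [exact: cvg_cst|apply: cvgM; [exact: cf|exact: cg]].
Qed.

(** [wform] is maximised on the compact unit sphere of the hyperplane [wsum u = 0], which [u0] shows
    to be nonempty; the first-order condition at a maximiser is the eigenvalue equation. *)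
Lemma rayleigh_max (u0 : 'I_n -> R) k : wsum w u0 = 0 -> u0 k != 0 ->
  exists l (v : 'I_n -> R), [/\ exists i, v i != 0,
    forall i, \sum_j w i j * v j = l * (mass w i * v i), wsum w v = 0 &
    forall u, wsum w u = 0 -> wform w u u <= l * wsum w (fun i => u i ^+ 2)].
Proof.
move=> u00 u0k.
have coord i : continuous (fun v : 'rV[R]_n => v ord0 i).
  exact: coord_continuous.
have normalize (u : 'I_n -> R) i : u i != 0 -> wsum w u = 0 ->
    exists s, [/\ 0 < s, wsum w (fun i => s * u i) = 0 &
      wsum w (fun i => (s * u i) ^+ 2) = 1].
  move=> ui wu; exists (Num.sqrt (wsum w (fun i => u i ^+ 2)))^-1; split.
  - by rewrite invr_gt0 sqrtr_gt0 (wsum_sqr_gt0 mass_gt0 ui).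
  - by rewrite wsumZ wu mulr0.
  rewrite (eq_wsum _ (fun i => exprMn _ _ _)) wsumZ exprVn sqr_sqrtr.
    by rewrite mulVf // gt_eqF // (wsum_sqr_gt0 mass_gt0 ui).
  exact: wsum_sqr_ge0.
pose A : set 'rV[R]_n := [set v | wsum w (v ord0) = 0 /\
  wsum w (fun i => v ord0 i ^+ 2) = 1].
have clA : closed A.
  have -> : A = (fun v : 'rV[R]_n => wsum w (v ord0)) @^-1` [set 0] `&`
     (fun v : 'rV[R]_n => wsum w (fun i => v ord0 i ^+ 2)) @^-1` [set 1] by [].
  apply: closedI; (apply: preimage_closed => [v _|]; last exact: closed_eq).
    apply: (continuous_wsum (f := fun i (v : 'rV[R]_n) => v ord0 i)) => i.
    exact: coord.
  apply: (continuous_wsum (f := fun i (v : 'rV[R]_n) => v ord0 i ^+ 2)) => i.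
  exact: (cvgM (coord i v) (coord i v)).
(* [M] exceeds every [(mass w i)^-1], which bounds the squared coordinates; [1 <= M] turns this into
   a bound on the coordinates. *)
pose M := 1 + \sum_i (mass w i)^-1.
have M1 : 1 <= M by rewrite lerDl sumr_ge0 // => i _; rewrite invr_ge0 ltW.
have cA : compact A.
  apply: (@subclosed_compact _ _
    [set v : 'rV[R]_n | forall i, `[- M, M]%classic (v ord0 i)]) => //.
    by apply: (@rV_compact _ _ (fun=> `[- M, M]%classic)) => _; exact: segment_compact.
  move=> v [_ v1] i /=; rewrite in_itv /= -ler_norml.
  have vM : `|v ord0 i| ^+ 2 <= M.
    rewrite real_normK ?num_real //.
    have : mass w i * v ord0 i ^+ 2 <= 1.
      rewrite -v1 /wsum (bigD1 i) //= lerDl sumr_ge0 // => j _.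
      by rewrite mulr_ge0 ?sqr_ge0 // ltW.
    rewrite mulrC -ler_pdivlMr // div1r => /le_trans; apply.
    rewrite /M (bigD1 i) //= addrCA lerDl addr_ge0 // sumr_ge0 // => j _.
    by rewrite invr_ge0 ltW.
  have := normr_ge0 (v ord0 i); nra.
have [s0 [_ s01 s02]] := normalize u0 k u0k u00.
have rowE (u : 'I_n -> R) : (\row_i u i) ord0 =1 u by move=> i; rewrite mxE.
have A0 : A !=set0.
  exists (\row_i (s0 * u0 i)); split; first by rewrite (eq_wsum _ (rowE _)).
  by rewrite -s02; apply: eq_wsum => i; rewrite rowE.
have [|v vA vmax] := @EVT_max_rV R n (fun v => wform w (v ord0) (v ord0)) A A0 cA.
  apply: continuous_subspaceT => x.
  by apply: (continuous_wform (f := fun i (v : 'rV[R]_n) => v ord0 i)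
    (g := fun i (v : 'rV[R]_n) => v ord0 i)) => i; exact: coord.
move: vA; rewrite inE => -[v0 v1].
set l := wform w (v ord0) (v ord0) in vmax.
have maxl u : wsum w u = 0 -> wform w u u <= l * wsum w (fun i => u i ^+ 2).
  move=> wu; have [[i ui]|/forallNP u_0] := pselect (exists i, u i != 0); last first.
    have {}u_0 i : u i = 0 by apply/eqP/negPn/negP/u_0.
    rewrite /wform /wsum !big1 ?mulr0 // => i _.
      by rewrite u_0 expr0n mulr0.
    by rewrite big1 // => j _; rewrite u_0 mul0r mulr0.
  have [s [s_gt0 s1 s2]] := normalize _ _ ui wu.
  have : wform w (fun i => s * u i) (fun i => s * u i) <= l.
    rewrite -(eq_wform w (rowE _) (rowE _)); apply: vmax; rewrite inE; split.
      by rewrite (eq_wsum _ (rowE _)).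
    by rewrite -s2; apply: eq_wsum => j; rewrite rowE.
  rewrite wformZr wformC // wformZr mulrA -expr2 => sl.
  move: s2; rewrite (eq_wsum _ (fun i => exprMn _ _ _)) wsumZ => s2.
  by rewrite -(ler_pM2l (exprn_gt0 2 s_gt0)) mulrCA s2 mulr1.
(* Stationarity: the maximiser is compared with its translates by [t * h], for all [t]. *)
have B0 h : wsum w h = 0 -> wform w (v ord0) h = l * wsum w (fun i => v ord0 i * h i).
  move=> wh; apply/eqP; rewrite -subr_eq0; apply/eqP.
  apply: (@linear_coef_eq0 _ (wform w h h - l * wsum w (fun i => h i ^+ 2))) => t.
  have := maxl (fun i => 1 * v ord0 i + t * h i).
  rewrite wsumD !wsumZ v0 wh !mulr0 addr0 => /(_ erefl).
  rewrite wform_sqrDZ // wsum_sqrDZ v1.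
  rewrite -/l; lra.
exists l, (v ord0); split => //.
- have [//|/forallNP H] := pselect (exists i, v ord0 i != 0).
  have : wsum w (fun i => v ord0 i ^+ 2) = 0.
    rewrite /wsum big1 // => i _.
    have -> : v ord0 i = 0 by apply/eqP/negPn/negP/H.
    by rewrite expr0n mulr0.
  by rewrite v1 => /eqP; rewrite oner_eq0.
- move=> i.
  (* The indicator of [i] is brought into the hyperplane by subtracting its mean [a]. The constant
     part drops out because both its [wform] and its weighted product with [v] equal
     [wsum v = 0]. *)
  pose d j : R := (j == i)%:R.
  have d1 : 0 < wsum w (fun=> 1).
    rewrite (lt_le_trans (mass_gt0 k)) // /wsum (bigD1 k) //= mulr1 lerDl.
    by rewrite sumr_ge0 // => j _; rewrite mulr1 ltW.
  pose a := wsum w d / wsum w (fun=> 1).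
  have := B0 (fun j => d j + - a * 1).
  rewrite wsumD wsumZ /a mulNr divfK ?gt_eqF // subrr => /(_ erefl).
  rewrite wformDr wformZr.
  have -> : wform w (v ord0) (fun=> 1) = 0.
    rewrite -v0 wsum_double; apply: eq_bigr => j _; apply: eq_bigr => ? _.
    by rewrite mulr1.
  rewrite mulr0 addr0.
  have -> : wform w (v ord0) d = \sum_j w i j * v ord0 j.
    rewrite wformC // wformE (bigD1 i) //= /d eqxx mul1r [X in _ + X]big1 ?addr0 //.
    by move=> j ji; rewrite (negPf ji) mul0r.
  move=> ->; congr (_ * _).
  rewrite (eq_wsum _ (_ : _ =1 fun j => v ord0 j * d j + - a * v ord0 j)).
    rewrite wsumD wsumZ v0 mulr0 addr0 /wsum (bigD1 i) //= /d eqxx mulr1.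
    by rewrite big1 ?addr0 // => j ji; rewrite (negPf ji) !mulr0.
  by move=> j; rewrite mulrDr mulr1 mulrC [_ * - a]mulrC [d j * _]mulrC.
Qed.

End Rayleigh.

(** * Existence of sign-changing equilibria *)

Section ContinuousAt.
Variables (R : realType) (T : topologicalType) (v : T).
Implicit Types f g : T -> R.

Lemma continuous_atD f g : continuous_at v f -> continuous_at v g ->
  continuous_at v (fun t => f t + g t).
Proof. exact: cvgD. Qed.

Lemma continuous_atB f g : continuous_at v f -> continuous_at v g ->
  continuous_at v (fun t => f t - g t).
Proof. exact: cvgB. Qed.

Lemma continuous_atM f g : continuous_at v f -> continuous_at v g ->
  continuous_at v (fun t => f t * g t).
Proof. exact: cvgM. Qed.

Lemma continuous_at_sum (I : Type) (s : seq I) (f : I -> T -> R) :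
  (forall i, continuous_at v (f i)) ->
  continuous_at v (fun t => \sum_(i <- s) f i t).
Proof. by move=> cf; apply: cvg_big => [|i _]; [exact: add_continuous|exact: cf]. Qed.

Lemma continuous_at_comp (h : R -> R) f : continuous_at v f ->
  continuous_at (f v) h -> continuous_at v (fun t => h (f t)).
Proof. exact: continuous_comp. Qed.

End ContinuousAt.

Lemma continuous_row (R : realType) (T : topologicalType) (n : nat)
    (f : 'I_n -> T -> R) :
  (forall i, continuous (f i)) -> continuous (fun t => \row_i f i t : 'rV[R]_n).
Proof.
move=> cf t A [P Pt PA].
have : \forall s \near t, forall j, P ord0 j (f j s).
  by apply: filter_forall => j; apply: cf; have := Pt ord0 j; rewrite mxE.
by apply: filterS => s Ps; apply: PA => i j; rewrite mxE ord1; exact: Ps.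
Qed.

Lemma open_row_forall (R : realType) (n : nat) (D : set R) : open D ->
  open [set x : 'rV[R]_n | forall i, D (x ord0 i)].
Proof.
move=> oD; rewrite openE => x Dx; exists (fun=> fun=> D) => [i j|y Dy j] /=.
  by rewrite ord1; apply: open_nbhs_nbhs.
exact: Dy.
Qed.

Lemma closed_row_forall (R : realType) (n : nat) (D : set R) : closed D ->
  closed [set x : 'rV[R]_n | forall i, D (x ord0 i)].
Proof.
move=> cD; have -> : [set x : 'rV[R]_n | forall i, D (x ord0 i)] =
    \bigcap_i ((fun x : 'rV[R]_n => x ord0 i) @^-1` D).
  by apply/seteqP; split=> [x Dx i _|x Dx i]; exact: Dx.
apply: closed_bigI => i _; apply: preimage_closed => // x _.
exact: coord_continuous.
Qed.

(** * The damped iteration and its invariant sets *)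

Section Dynamics.
Variables (R : realType) (n : nat) (w : 'I_n -> 'I_n -> R).
Variables (psi : 'I_n -> R -> R) (p : R).

Hypothesis w_ge0 : forall i j, 0 <= w i j.
Hypothesis w_sym : forall i j, w i j = w j i.
Hypothesis w_conn : forall P : pred 'I_n, (exists i, P i) ->
  (forall i j, P i -> 0 < w i j -> P j) -> forall i, P i.
Hypothesis mass_gt0 : forall i, 0 < mass w i.
Hypothesis psi_sig : forall i, sigmoidal (psi i).
Hypothesis p_gt0 : 0 < p.

Let force (x : 'rV[R]_n) i : R := \sum_j w i j * psi j (x ord0 j).

(* The explicit Euler step of size h = 1 / (1 + p) for x' = - x + p H1 psi(x).
   With (1 - h) / h = p the energy below decreases although w may be indefinite. *)
Let step (x : 'rV[R]_n) : 'rV[R]_n :=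
  \row_i (p / (1 + p) * (x ord0 i + force x i / mass w i)).

Let box : set 'rV[R]_n := [set x | forall i, `[- p, p]%classic (x ord0 i)].

Lemma step_mass x i :
  mass w i * ((1 + p) * step x ord0 i - p * x ord0 i) = p * force x i.
Proof.
have p0 := p_gt0; have := mass_gt0 i; rewrite mxE => mi; field; apply/andP; split; lra.
Qed.

(** The sigmoids are bounded by 1, so [force] is bounded by [mass], and the radius [p] is the fixed
    point of the resulting bound [c |-> p / (1 + p) * (c + 1)]. *)
Lemma step_box x : box x -> box (step x).
Proof.
have p0 := p_gt0; move=> bx i; rewrite /= in_itv /= -ler_norml mxE normrM.
have c0 : 0 < p / (1 + p) by apply: divr_gt0; lra.
rewrite (gtr0_norm c0).
have xi : `|x ord0 i| <= p by have := bx i; rewrite /= in_itv /= -ler_norml.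
have fi : `|force x i / mass w i| <= 1.
  rewrite normrM normfV (gtr0_norm (mass_gt0 i)) ler_pdivrMr // mul1r.
  apply: le_trans (ler_norm_sum _ _ _) _; apply: ler_sum => j _.
  rewrite normrM (ger0_norm (w_ge0 i j)) -[leRHS]mulr1 ler_wpM2l //.
  exact: sigmoidal_norm_le1.
have Ep : p = p / (1 + p) * (p + 1) by field; lra.
rewrite [leRHS]Ep ler_pM2l //; apply: le_trans (ler_normD _ _) _; exact: lerD.
Qed.

Lemma continuous_step : continuous step.
Proof.
apply: continuous_row => i x; apply: continuous_atM; first exact: cst_continuous.
apply: continuous_atD; first exact: coord_continuous.
apply: continuous_atM; last exact: cst_continuous.
apply: continuous_at_sum => j; apply: continuous_atM; first exact: cst_continuous.
apply: continuous_at_comp; first exact: coord_continuous.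
exact: sigmoidal_continuous.
Qed.

Lemma continuous_iter_step k : continuous (iter k step).
Proof.
elim: k => [|k IH] x; first exact: cvg_id.
by apply: (@continuous_comp _ _ _ (iter k step) step);
  [exact: IH|exact: continuous_step].
Qed.

Let pos : set 'rV[R]_n := [set x | forall i, [set y : R | 0 < y] (x ord0 i)].
Let neg : set 'rV[R]_n := [set x | forall i, [set y : R | y < 0] (x ord0 i)].

Lemma step_pos x : pos x -> pos (step x).
Proof.
have p0 := p_gt0; move=> px i /=; rewrite mxE mulr_gt0 //; first by apply: divr_gt0; lra.
have := px i => /= xi; rewrite ltr_wpDr // divr_ge0 ?(ltW (mass_gt0 i)) //.
apply: sumr_ge0 => j _; rewrite mulr_ge0 // -(sigmoidal0 (psi_sig j)).
by rewrite sigmoidal_mono // ltW //; exact: px.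
Qed.

Lemma step_neg x : neg x -> neg (step x).
Proof.
have p0 := p_gt0; move=> px i /=; rewrite mxE pmulr_rlt0 //; last by apply: divr_gt0; lra.
have := px i => /= xi; rewrite -[ltRHS]add0r ltr_leD //.
rewrite pmulr_lle0 ?invr_gt0 //.
rewrite -oppr_ge0 -sumrN; apply: sumr_ge0 => j _; rewrite -mulrN mulr_ge0 // oppr_ge0.
rewrite -(sigmoidal0 (psi_sig j)).
by rewrite sigmoidal_mono // ltW //; exact: px.
Qed.

Lemma iter_step_pos x k l : (k <= l)%N -> pos (iter k step x) -> pos (iter l step x).
Proof.
move=> /subnK <-; elim: (l - k)%N => // d IH /IH; rewrite addSn iterS.
exact: step_pos.
Qed.

Lemma iter_step_neg x k l : (k <= l)%N -> neg (iter k step x) -> neg (iter l step x).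
Proof.
move=> /subnK <-; elim: (l - k)%N => // d IH /IH; rewrite addSn iterS.
exact: step_neg.
Qed.

(** A strong maximum principle: at a vanishing coordinate a sum of terms of one sign is zero, so all
    neighbours vanish, and connectivity spreads this. The sign of [s] selects the orthant. *)
Lemma equilibrium_touching_orthant (s : R) (x : 'I_n -> R) :
  (forall i, mass w i * x i = p * \sum_j w i j * psi j (x j)) ->
  s != 0 -> (forall i, 0 <= s * x i) -> (exists i, x i = 0) -> forall i, x i = 0.
Proof.
move=> eq s0 sx [k xk] i; apply/eqP; move: i.
apply: w_conn => [|i j /eqP xi wij]; first by exists k; rewrite xk.
have sp l : 0 <= s * psi l (x l).
  have := sx l; case: (ltgtP s 0) s0 => // s0 _.
    rewrite !nmulr_rge0 // -[X in _ -> _ <= X](sigmoidal0 (psi_sig l)).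
    by rewrite sigmoidal_mono.
  rewrite !pmulr_rge0 // -[X in _ -> X <= _](sigmoidal0 (psi_sig l)).
  by rewrite sigmoidal_mono.
have /eqP : \sum_l w i l * (s * psi l (x l)) = 0.
  transitivity (s * \sum_l w i l * psi l (x l)).
    by rewrite mulr_sumr; apply: eq_bigr => l _; ring.
  have /eqP := eq i; rewrite xi mulr0 eq_sym mulf_eq0 gt_eqF //= => /eqP ->.
  by rewrite mulr0.
rewrite psumr_eq0 => [/allP H|l _]; last by rewrite mulr_ge0.
have := H j (mem_index_enum _); rewrite /= !mulf_eq0 (gt_eqF wij) (negPf s0) /=.
rewrite -[X in _ == X](sigmoidal0 (psi_sig j)).
by rewrite (inj_eq (inc_inj (sigmoidal_mono (psi_sig j)))).
Qed.

(** * The energy and its minimiser *)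

Section Energy.
Variable F : 'I_n -> R -> R.
Hypothesis F_derive : forall i x, - p - 1 < x -> is_derive x (1 : R) (F i) (psi i x).

(** A Hopfield energy: by equality in Young's inequality, [z * psi i z - (F i z - F i 0)] is the
    integral of the inverse of [psi i] from 0 to [psi i z]. *)
Let energy (x : 'rV[R]_n) : R :=
  wsum w (fun i => x ord0 i * psi i (x ord0 i) - (F i (x ord0 i) - F i 0)) -
  p / 2 * wform w (fun i => psi i (x ord0 i)) (fun i => psi i (x ord0 i)).

Lemma box_gt x i : box x -> - p - 1 < x ord0 i.
Proof. by have p0 := p_gt0; move/(_ i); rewrite /= in_itv /= => /andP[? _]; lra. Qed.

(** With [d] the increment of [psi], co-coercivity yields a gain of [p] times [wsum] of [d ^+ 2]. At
    most half of it is lost to [wform w d d], which may be negative. *)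
Lemma energy_step x : box x ->
  energy (step x) <= energy x -
    p / 2 * wsum w (fun i => (psi i (step x ord0 i) - psi i (x ord0 i)) ^+ 2).
Proof.
have p0 := p_gt0; move=> bx; have bx' := step_box bx; set x' := step x in bx' *.
pose d i := psi i (x' ord0 i) - psi i (x ord0 i).
have E1 : wsum w (fun i => x' ord0 i * psi i (x' ord0 i) - (F i (x' ord0 i) - F i 0)) <=
    wsum w (fun i => x ord0 i * psi i (x ord0 i) - (F i (x ord0 i) - F i 0)) +
    wsum w (fun i => x' ord0 i * d i).
  rewrite -wsumD; apply: ler_wsum => // i.
  have := sigmoidal_antiderivative_convex (psi_sig i) (F_derive i)
    (box_gt i bx) (box_gt i bx').
  by rewrite /d; lra.
have E2 : wform w (fun i => psi i (x' ord0 i)) (fun i => psi i (x' ord0 i)) =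
    wform w (fun i => psi i (x ord0 i)) (fun i => psi i (x ord0 i)) +
    2 * wform w d (fun i => psi i (x ord0 i)) + wform w d d.
  rewrite [in RHS]wformC // -wform_sqrD //; apply: eq_wform => i; rewrite /d; ring.
have E3 : p * wform w d (fun i => psi i (x ord0 i)) =
    wsum w (fun i => ((1 + p) * x' ord0 i - p * x ord0 i) * d i).
  rewrite wformE mulr_sumr; apply: eq_bigr => i _.
  transitivity (d i * (p * force x i)); first by rewrite /force; ring.
  by rewrite -step_mass -/x'; ring.
(* The factor on the right is [x' + p * (x' - x)], so co-coercivity applies to its second term. *)
have E4 : p * wsum w (fun i => d i ^+ 2) + wsum w (fun i => x' ord0 i * d i) <=
    wsum w (fun i => ((1 + p) * x' ord0 i - p * x ord0 i) * d i).
  rewrite -wsumZ -wsumD; apply: ler_wsum => // i.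
  have := sigmoidal_contraction (psi_sig i) (x ord0 i) (x' ord0 i).
  rewrite -/(d i) -(ler_pM2l p_gt0); lra.
have E5 : - wform w d d <= wsum w (fun i => d i ^+ 2).
  by apply: le_trans (wform_abs_le_wsum _ _ d) => //; rewrite -normrN ler_norm.
rewrite /energy E2; move: E5; rewrite -(ler_pM2l p_gt0); lra.
Qed.

Lemma continuous_energy : {in box, continuous energy}.
Proof.
move=> x; rewrite inE => bx.
have cx i : continuous_at x (fun x : 'rV[R]_n => x ord0 i).
  exact: coord_continuous.
have cpsi i : continuous_at x (fun x : 'rV[R]_n => psi i (x ord0 i)).
  by apply: continuous_at_comp => //; exact: sigmoidal_continuous.
rewrite /energy; apply: continuous_atB.
  apply: (continuous_wsum (f := fun i (x : 'rV[R]_n) =>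
    x ord0 i * psi i (x ord0 i) - (F i (x ord0 i) - F i 0))) => i.
  apply: continuous_atB; first exact: continuous_atM.
  apply: continuous_atB; last exact: cst_continuous.
  apply: continuous_at_comp => //.
  apply/differentiable_continuous/derivable1_diffP.
  by have [] := F_derive i (box_gt i bx).
apply: continuous_atM; first exact: cst_continuous.
exact: (continuous_wform (f := fun i (x : 'rV[R]_n) => psi i (x ord0 i))
  (g := fun i (x : 'rV[R]_n) => psi i (x ord0 i))).
Qed.

Lemma energy0 : energy 0 = 0.
Proof.
rewrite /energy /wsum /wform !big1 => [||i _]; first by rewrite mulr0 subr0.
- move=> i _; rewrite big1 // => j _.
  by rewrite !mxE sigmoidal0 // mul0r mulr0.
- by rewrite mxE mul0r !subrr mulr0.
Qed.

(** Near 0 the energy is close to half of [wsum] of squares minus [p] times [wform]. The first part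
    is at most [(1 + e) / 2 * M]; replacing [psi] by the identity in the form costs [3 * e * M], one
    [e] for each error term of a product, the quadratic one using [e <= 1]. *)
Lemma energy_lt0 (lam e r : R) x : 0 < e -> e <= 1 -> e * (1 + 3 * p) < p * lam - 1 ->
  (forall i z, `|z| <= r -> `|psi i z - z| <= e * `|z|) ->
  box x -> (forall i, `|x ord0 i| <= r) -> 0 < wsum w (fun i => x ord0 i ^+ 2) ->
  lam * wsum w (fun i => x ord0 i ^+ 2) <= wform w (x ord0) (x ord0) ->
  energy x < 0.
Proof.
have p0 := p_gt0; move=> e0 e1 elam psi_e bx xr.
set M := wsum w (fun i => x ord0 i ^+ 2) => M0 lamM.
have E1 : wsum w (fun i => x ord0 i * psi i (x ord0 i) - (F i (x ord0 i) - F i 0))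
    <= (1 + e) / 2 * M.
  rewrite -wsumZ; apply: ler_wsum => // i; set z := x ord0 i.
  have l0 : - p - 1 < 0 by lra.
  have := sigmoidal_antiderivative_ge (F_derive i) l0 (box_gt i bx) (psi_e i) (xr i).
  rewrite -/z => Fz.
  suff : z * psi i z <= z ^+ 2 by lra.
  have := sigmoidal_contraction (psi_sig i) 0 z; rewrite sigmoidal0 // !subr0.
  have [z0|z0] := leP 0 z; first by have := sigmoidal_le_id (psi_sig i) z0; nra.
  have nz0 : 0 <= - z by lra.
  by have := sigmoidal_le_id (psi_sig i) nz0; rewrite (sigmoidal_odd (psi_sig i)); nra.
have E2 : wform w (x ord0) (x ord0) - 3 * e * M <=
    wform w (fun i => psi i (x ord0 i)) (fun i => psi i (x ord0 i)).
  have A : wform w (fun i => `|x ord0 i|) (fun i => `|x ord0 i|) <= M.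
    apply: le_trans (wform_le_wsum w_ge0 w_sym _) _.
    by apply: ler_wsum => // i; rewrite real_normK ?num_real.
  have e3 : 0 <= 3 * e by lra.
  rewrite lerBlDr; apply: le_trans _ (lerD (lexx _) (ler_wpM2l e3 A)).
  rewrite mulr_sumr -big_split /=; apply: ler_sum => i _.
  rewrite mulr_sumr -big_split /=; apply: ler_sum => j _.
  rewrite (mulrCA (3 * e)) -mulrDr ler_wpM2l //.
  have := psi_e i _ (xr i); have := psi_e j _ (xr j).
  set a := x ord0 i; set b := x ord0 j; set a' := psi i a; set b' := psi j b => hb ha.
  have : `|a * b - a' * b'| <= 3 * e * (`|a| * `|b|).
    have -> : a * b - a' * b' =
        - ((a' - a) * b + a * (b' - b) + (a' - a) * (b' - b)) by ring.
    rewrite normrN; apply: le_trans (ler_normD _ _) _.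
    have := ler_normD ((a' - a) * b) (a * (b' - b)); rewrite !normrM.
    have h1 : `|a' - a| * `|b| <= e * (`|a| * `|b|) by rewrite mulrA ler_wpM2r.
    have h2 : `|a| * `|b' - b| <= e * (`|a| * `|b|) by rewrite mulrCA ler_wpM2l.
    have h3 : `|a' - a| * `|b' - b| <= e * (`|a| * `|b|).
      apply: le_trans (ler_pM _ _ ha hb) _ => //.
      have -> : e * `|a| * (e * `|b|) = e * (e * (`|a| * `|b|)) by ring.
      have ab0 : 0 <= e * (`|a| * `|b|) by rewrite mulr_ge0 ?mulr_ge0 // ltW.
      by rewrite -[leRHS]mul1r ler_wpM2r.
    lra.
  by rewrite ler_norml => /andP[_ ?]; lra.
have E3 : p * (lam * M - 3 * e * M) <=
    p * wform w (fun i => psi i (x ord0 i)) (fun i => psi i (x ord0 i)).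
  by rewrite ler_pM2l //; lra.
have : (1 + e + 3 * e * p - p * lam) * M < 0 by rewrite pmulr_llt0 //; lra.
rewrite /energy; lra.
Qed.

(** The case [k = 0] keeps the points themselves out of the two open orthants; quantifying over all
    [k] makes the set stable under [step]. *)
Let invariant : set 'rV[R]_n := [set x | box x /\
  forall k, ~ pos (iter k step x) /\ ~ neg (iter k step x)].

Lemma closed_iter_avoid (D : set 'rV[R]_n) : open D ->
  closed [set x | forall k, ~ D (iter k step x)].
Proof.
move=> oD; have -> : [set x | forall k, ~ D (iter k step x)] =
    \bigcap_k (iter k step @^-1` ~` D).
  by apply/seteqP; split=> [x Dx k _|x Dx k]; exact: Dx.
apply: closed_bigI => k _; apply: preimage_closed => [x _|].
  exact: continuous_iter_step.
exact: open_closedC.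
Qed.

Lemma compact_invariant : compact invariant.
Proof.
have cbox : compact box.
  by apply: (@rV_compact _ _ (fun=> `[- p, p]%classic)) => _; exact: segment_compact.
apply: subclosed_compact cbox _ => [|x []//].
have -> : invariant = box `&` ([set x | forall k, ~ pos (iter k step x)] `&`
    [set x | forall k, ~ neg (iter k step x)]).
  apply/seteqP; split=> x; first by move=> [bx H]; split=> //; split=> k; have [] := H k.
  by move=> [bx [H1 H2]]; split.
apply: closedI; first by apply: closed_row_forall; exact: itv_closed.
by apply: closedI; apply: closed_iter_avoid; apply: open_row_forall;
  [exact: open_gt|exact: open_lt].
Qed.

Lemma invariant_step x : invariant x -> invariant (step x).
Proof.
move=> [bx H]; split; first exact: step_box.
by move=> k; rewrite -iterSr; exact: H.
Qed.

(* R is connected, so it is not the union of the two disjoint nonempty open sets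
   of times whose orbit enters the interior of the positive or negative orthant. *)
Lemma path_meets_invariant (X : R -> 'rV[R]_n) (a b : R) (k0 : 'I_n) : continuous X ->
  (forall t, box (X t)) -> pos (X a) -> neg (X b) -> exists t, invariant (X t).
Proof.
move=> cX bX pa nb.
pose enter (D : set 'rV[R]_n) : set R := [set t | exists k, D (iter k step (X t))].
have open_enter D : open D -> open (enter D).
  move=> oD; have -> : enter D = \bigcup_k ((fun t => iter k step (X t)) @^-1` D).
    by apply/seteqP; split=> [t [k Dk]|t [k _ Dk]]; exists k.
  apply: bigcup_open => k _; apply: open_comp => // t _.
  by apply: (@continuous_comp _ _ _ X (iter k step));
    [exact: cX|exact: continuous_iter_step].
have [//|/forallNP none] := pselect (exists t, invariant (X t)).
(* An orbit stays in the open orthant it enters, so at the later of the two times coordinate [k0]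
   would have both signs. *)
have disj t : enter pos t -> enter neg t -> False.
  move=> [k Hk] [l Hl].
  have := iter_step_pos (leq_maxl k l) Hk => /(_ k0) /=.
  have := iter_step_neg (leq_maxr k l) Hl => /(_ k0) /=; lra.
have cover t : enter pos t \/ enter neg t.
  have [|np] := pselect (enter pos t); first by left.
  have [|nn] := pselect (enter neg t); first by right.
  case: (none t); split=> // k.
  by split=> H; [apply: np|apply: nn]; exists k.
have cR : connected [set: R] by apply/connected_intervalP.
have E : enter pos = [set: R].
  apply: cR; first by exists a; exists 0%N.
    exists (enter pos); last by rewrite setTI.
    by apply: open_enter; apply: open_row_forall; exact: open_gt.
  exists (~` enter neg).
    apply: open_closedC; apply: open_enter; apply: open_row_forall; exact: open_lt.
  rewrite setTI; apply/seteqP; split=> t; first by move=> ? /disj; exact.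
  by move=> /= nt; case: (cover t).
case: (disj b); last by exists 0%N.
by rewrite E.
Qed.

(** [step] stays in the set, so the energy cannot drop there; the increment of [psi] vanishes, and
    [psi] is injective. *)
Lemma minimizer_fixed x : invariant x ->
  (forall y, invariant y -> energy x <= energy y) ->
  forall i, mass w i * x ord0 i = p * force x i.
Proof.
have p0 := p_gt0; move=> ix xmin i; have bx := ix.1.
have := energy_step bx; have := xmin _ (invariant_step ix).
set D := wsum w _ => h1 h2.
have D0 : D = 0.
  apply/eqP; rewrite eq_le wsum_sqr_ge0 // andbT -(@pmulr_rle0 _ (p / 2)); last by lra.
  by lra.
have {}D0 j : step x ord0 j = x ord0 j.
  have := wsum_sqr_eq0 mass_gt0 D0 j => /eqP; rewrite subr_eq0.
  by rewrite (inj_eq (inc_inj (sigmoidal_mono (psi_sig j)))) => /eqP.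
by rewrite -step_mass D0; ring.
Qed.

(** The minimiser has negative energy, hence is nonzero. If it had only one weak sign, a zero
    coordinate would make it vanish, and no zero coordinate would put it in an open orthant. *)
Lemma sign_changing_equilibrium_of_path (X : R -> 'rV[R]_n) (a b : R) (k0 : 'I_n) :
  continuous X -> (forall t, box (X t)) -> pos (X a) -> neg (X b) ->
  (forall t, energy (X t) < 0) ->
  exists x : 'I_n -> R,
    [/\ forall i, mass w i * x i = p * \sum_j w i j * psi j (x j),
        exists i, 0 < x i & exists i, x i < 0].
Proof.
move=> cX bX pa nb EX.
have [t it] := path_meets_invariant k0 cX bX pa nb.
have inv0 : invariant !=set0 by exists (X t).
have [|x] := @EVT_min_rV R n energy invariant inv0 compact_invariant.
  apply: continuous_in_subspaceT => x; rewrite inE => -[bx _].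
  by apply: continuous_energy; rewrite inE.
rewrite inE => ix xmin.
have fix_x := minimizer_fixed ix (fun y iy => xmin y (mem_set iy)).
have Ex : energy x < 0 by apply: le_lt_trans (xmin _ (mem_set it)) (EX t).
have x0 : ~ (forall i, x ord0 i = 0).
  move=> x0; have : x = 0 by apply/rowP => i; rewrite x0 mxE.
  by move=> x00; move: Ex; rewrite x00 energy0 ltxx.
have [np nn] := ix.2 0%N.
have touch := @equilibrium_touching_orthant _ (x ord0) fix_x.
exists (x ord0); split=> //.
- have [//|/forallNP H] := pselect (exists i, 0 < x ord0 i).
  have {}H i : x ord0 i <= 0 by rewrite leNgt; apply/negP/H.
  case: nn => i /=; rewrite lt_neqAle H andbT; apply/eqP => xi; case: x0.
  apply: (touch (-1)) => [|j|]; first by rewrite oppr_eq0 oner_eq0.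
    by rewrite mulN1r oppr_ge0.
  by exists i.
- have [//|/forallNP H] := pselect (exists i, x ord0 i < 0).
  have {}H i : 0 <= x ord0 i by rewrite leNgt; apply/negP/H.
  case: np => i /=; rewrite lt_neqAle H andbT; apply/eqP => xi; case: x0.
  apply: (touch 1) => [|j|]; first by rewrite oner_eq0.
    by rewrite mul1r.
  by exists i.
Qed.

End Energy.

Lemma sign_changing_equilibrium_exists (lam : R) (v : 'I_n -> R) :
  (forall i, \sum_j w i j * v j = lam * (mass w i * v i)) -> wsum w v = 0 ->
  (exists i, v i != 0) -> 1 < p * lam ->
  exists x : 'I_n -> R,
    [/\ forall i, mass w i * x i = p * \sum_j w i j * psi j (x j),
        exists i, 0 < x i & exists i, x i < 0].
Proof.
have p0 := p_gt0; move=> eigv v0 [k0 vk0] plam.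
pose one (i : 'I_n) : R := 1.
have W11 : wform w one one = wsum w (fun i => one i ^+ 2).
  rewrite wformE; apply: eq_bigr => i _; rewrite /mass /one expr1n mulr1 mul1r.
  by apply: eq_bigr => j _; rewrite mulr1.
have W1v : wform w one v = 0.
  rewrite wformE; transitivity (lam * wsum w v); last by rewrite v0 mulr0.
  by rewrite mulr_sumr; apply: eq_bigr => i _; rewrite eigv mul1r.
have M1v : wsum w (fun i => one i * v i) = 0.
  by rewrite -v0; apply: eq_wsum => i; rewrite mul1r.
have Wvv : wform w v v = lam * wsum w (fun i => v i ^+ 2).
  by rewrite wformE mulr_sumr; apply: eq_bigr => i _; rewrite eigv; ring.
have M1 : 0 < wsum w (fun i => one i ^+ 2).
  by apply: (wsum_sqr_gt0 mass_gt0 (i := k0)); rewrite oner_eq0.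
have Mv : 0 < wsum w (fun i => v i ^+ 2) by apply: wsum_sqr_gt0 vk0.
have lam1 : lam <= 1.
  by rewrite -(ler_pM2r Mv) mul1r -Wvv; exact: wform_le_wsum.
(* Half of the largest tolerance allowed by [energy_lt0], which makes the required inequality
   strict. *)
pose e := Num.min 1 ((p * lam - 1) / (2 * (1 + 3 * p))).
have e0 : 0 < e by rewrite lt_min ltr01 divr_gt0 //; lra.
have e1 : e <= 1 by rewrite ge_min lexx.
have elam : e * (1 + 3 * p) < p * lam - 1.
  apply: (@le_lt_trans _ _ ((p * lam - 1) / (2 * (1 + 3 * p)) * (1 + 3 * p))).
    by rewrite ler_pM2r; [rewrite ge_min lexx orbT|lra].
  have -> : (p * lam - 1) / (2 * (1 + 3 * p)) * (1 + 3 * p) = (p * lam - 1) / 2.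
    by field; lra.
  by lra.
have [r r0 psi_e] : exists2 r : R, 0 < r &
    forall i z, `|z| <= r -> `|psi i z - z| <= e * `|z|.
  have /choice[r rP] i : exists r, 0 < r /\
      forall z, `|z| <= r -> `|psi i z - z| <= e * `|z|.
    by have [r] := sigmoidal_near0 (psi_sig i) e0; exists r.
  exists (\big[Num.min/1]_i r i) => [|i z zr].
    by apply: lt_bigmin => // i _; exact: (rP i).1.
  apply: (rP i).2; apply: le_trans zr _; exact: bigmin_le_cond.
(* The denominator bounds the coordinates of every combination of 1 and [v] with coefficients in
   [-1, 1], so the circle below stays within both [r] and [p]. *)
pose s : R := Num.min r p / (1 + \sum_i `|v i|).
have V0 : 0 < 1 + \sum_i `|v i| by rewrite ltr_wpDr // sumr_ge0.
have m0 : 0 < Num.min r p by rewrite lt_min r0.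
have s0 : 0 < s by rewrite divr_gt0.
(* At [t = 0] and [t = pi] the curve is at [s] and [- s] times the constant vector, in opposite open
   orthants. *)
pose X t : 'rV[R]_n := \row_i ((s * cos t) * one i + (s * sin t) * v i).
have XE t i : X t ord0 i = (s * cos t) * one i + (s * sin t) * v i by rewrite mxE.
have Xm t i : `|X t ord0 i| <= Num.min r p.
  have vi : `|v i| <= \sum_i `|v i| by rewrite (bigD1 i) //= lerDl sumr_ge0.
  have -> : Num.min r p = s * (1 + \sum_i `|v i|) by rewrite divfK ?gt_eqF.
  have -> : X t ord0 i = s * (cos t * one i + sin t * v i) by rewrite XE; ring.
  rewrite normrM (gtr0_norm s0) ler_pM2l //.
  apply: le_trans (ler_normD _ _) _; rewrite !normrM normr1 mulr1.
  have c1 : `|cos t| <= 1 by rewrite ler_norml cos_geN1 cos_le1.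
  have s1 : `|sin t| <= 1 by rewrite ler_norml sin_geN1 sin_le1.
  by rewrite lerD // -[leRHS]mul1r; apply: le_trans (ler_wpM2r _ s1) _ => //; rewrite !mul1r.
have Xr t i : `|X t ord0 i| <= r by apply: le_trans (Xm t i) _; rewrite ge_min lexx.
have bX t : box (X t).
  move=> i /=; rewrite in_itv /= -ler_norml; apply: le_trans (Xm t i) _.
  by rewrite ge_min lexx orbT.
have cX : continuous X.
  apply: continuous_row => i t; apply: continuous_atD.
    apply: continuous_atM; last exact: cst_continuous.
    by apply: continuous_atM; [exact: cst_continuous|exact: continuous_cos].
  apply: continuous_atM; last exact: cst_continuous.
  by apply: continuous_atM; [exact: cst_continuous|exact: continuous_sin].
have [F F_derive] : exists F : 'I_n -> R -> R, forall i x, - p - 1 < x ->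
    is_derive x (1 : R) (F i) (psi i x).
  have /choice[F F_derive] i : exists F : R -> R, forall x, - p - 1 < x ->
      is_derive x (1 : R) F (psi i x).
    by apply: continuous_antiderivative; exact: sigmoidal_continuous.
  by exists F.
apply: (@sign_changing_equilibrium_of_path F F_derive X 0 pi k0) => //.
- by move=> i /=; rewrite XE cos0 sin0 !mulr0 mul0r addr0 !mulr1.
- by move=> i /=; rewrite XE cospi sinpi !mulr0 mul0r addr0 mulr1 mulrN1 oppr_lt0.
move=> t; have cs := cos2Dsin2 t.
have EM : wsum w (fun i => X t ord0 i ^+ 2) =
  (s * cos t) ^+ 2 * wsum w (fun i => one i ^+ 2) +
  (s * sin t) ^+ 2 * wsum w (fun i => v i ^+ 2).
  by rewrite (eq_wsum _ (fun i => congr1 (fun z => z ^+ 2) (XE t i))) wsum_sqrDZ M1v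
    mulr0 addr0.
have EW : wform w (X t ord0) (X t ord0) =
  (s * cos t) ^+ 2 * wsum w (fun i => one i ^+ 2) +
  (s * sin t) ^+ 2 * (lam * wsum w (fun i => v i ^+ 2)).
  by rewrite (eq_wform _ (XE t) (XE t)) wform_sqrDZ // W1v W11 Wvv mulr0 addr0.
apply: (energy_lt0 F_derive e0 e1 elam psi_e (bX t) (Xr t)).
  set a := wsum w _ in M1 EM EW *; set b := wsum w (fun i => v i ^+ 2) in Mv EM EW *.
  have S0 := sqr_ge0 (sin t); have C0 := sqr_ge0 (cos t).
  have -> : wsum w (fun i => X t ord0 i ^+ 2) =
      s ^+ 2 * (cos t ^+ 2 * a + (1 - cos t ^+ 2) * b).
    by rewrite EM -cs; ring.
  (* A convex combination of [a] and [b] is at least the smaller of the two. *)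
  rewrite mulr_gt0 ?exprn_gt0 //; case: (leP a b) => ab.
    by have := mulr_ge0 S0 (_ : 0 <= b - a); nra.
  by have := mulr_ge0 C0 (_ : 0 <= a - b); nra.
(* The component along [v] has quotient [lam], the constant one has quotient 1, which is at least
   [lam]. *)
rewrite EM EW mulrDr lerD //; last by rewrite mulrCA.
rewrite -[leRHS]mul1r ler_wpM2r // mulr_ge0 ?sqr_ge0 //; exact: ltW.
Qed.

End Dynamics.

(** * The spectrum of H1 *)

Lemma irreducible_gt1 (R : realType) (n : nat) (A : 'M[R]_n) :
  (0 < n)%N -> irreducible_mx A -> null_diag A -> (1 < n)%N.
Proof.
case: n A => [|[|n]] // A _ irr diag0; case: irr; left; split=> //.
by apply/matrixP => i j; rewrite !ord1 diag0 mxE.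
Qed.

(** Listing the indices outside [P] first and those in [P] last gives a permutation with a zero
    lower left block; [k] and [i0] make both diagonal blocks nonempty. *)
Lemma irreducible_closed (R : realType) (n : nat) (A : 'M[R]_n) (P : pred 'I_n) :
  irreducible_mx A -> (exists i, P i) ->
  (forall i j, P i -> A i j != 0 -> P j) -> forall i, P i.
Proof.
move=> irr [i0 Pi0] PA k; apply/negPn/negP => Pk; apply: irr; right.
pose L := enum (predC P) ++ enum P.
have sL : size L = n by rewrite size_cat -!cardE addnC cardC card_ord.
have uL : uniq L.
  rewrite cat_uniq !enum_uniq andbT /=; apply/hasPn => i.
  by rewrite !mem_enum inE /= negbK.
have injL : injective (fun i : 'I_n => nth i L i).
  move=> i j; rewrite (set_nth_default j) ?sL // => /eqP.
  by rewrite nth_uniq ?sL // => /eqP/val_inj.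
exists (perm injL), (size (enum (predC P))); split.
  rewrite -cardE; apply/andP; split; first by apply/card_gt0P; exists k.
  apply: (@leq_trans (#|P| + #|predC P|)); last by rewrite cardC card_ord.
  by rewrite -[X in (X < _)%N]add0n ltn_add2r; apply/card_gt0P; exists i0.
move=> i j ri jr; rewrite !mxE !permE; apply/eqP.
have Pi : P (nth i L i).
  rewrite nth_cat ltnNge ri /=.
  have : nth i (enum P) (i - size (enum (predC P))) \in enum P.
    by rewrite mem_nth // ltn_subLR // -size_cat sL.
  by rewrite mem_enum.
apply/negPn/negP => /(PA _ _ Pi).
have : nth j (enum (predC P)) j \in enum (predC P) by rewrite mem_nth.
by rewrite nth_cat jr mem_enum inE /= => /negP.
Qed.

(** * From the matrix to the weighted graph *)

Section Translation.
Variables (R : realType) (n : nat) (A : 'M[R]_n).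
Variable d : 'rV[R]_n.
Hypothesis n_gt1 : (1 < n)%N.
Hypothesis A_ge0 : nonneg_mx A.
Hypothesis A_irr : irreducible_mx A.
Hypothesis d_gt0 : forall i, 0 < d 0 i.
Hypothesis dA_sym : diag_mx d *m A \is symmetricmx.

Definition edge_weight i j := d 0 i * A i j.
Let w := edge_weight.

Lemma edge_weight_ge0 i j : 0 <= w i j.
Proof. by rewrite mulr_ge0 ?A_ge0 // ltW. Qed.

Lemma edge_weight_sym i j : w i j = w j i.
Proof.
move: dA_sym => /is_hermitianmxP; rewrite expr0 scale1r map_mx_id //.
by rewrite mul_diag_mx => /matrixP/(_ i j); rewrite !mxE.
Qed.

Lemma edge_weight_conn (P : pred 'I_n) : (exists i, P i) ->
  (forall i j, P i -> 0 < w i j -> P j) -> forall i, P i.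
Proof.
move=> P0 PA; apply: (irreducible_closed A_irr P0) => i j Pi Aij; apply: PA Pi _.
by rewrite mulr_gt0 // lt_def Aij A_ge0.
Qed.

Lemma mass_edge_weight i : mass w i = d 0 i * \sum_j A i j.
Proof. by rewrite mulr_sumr. Qed.

(** A zero row [i] would make the set of [i] alone closed under edges, hence everything, against
    [1 < n]. *)
Lemma row_sum_gt0 i : 0 < \sum_j A i j.
Proof.
rewrite lt_def sumr_ge0 ?andbT => [|j _]; last exact: A_ge0.
apply/eqP => /eqP; rewrite psumr_eq0 => [/allP A0|j _]; last exact: A_ge0.
have all_i : forall j, pred1 i j.
  apply: (irreducible_closed A_irr); first by exists i => /=.
  move=> j k /eqP -> /negP []; exact: A0 k (mem_index_enum _).
have /eqP h0 := all_i (Ordinal (ltnW n_gt1)).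
by have /eqP := all_i (Ordinal n_gt1); rewrite -h0 => /(congr1 val).
Qed.

Lemma mass_edge_weight_gt0 i : 0 < mass w i.
Proof. by rewrite mass_edge_weight mulr_gt0 ?row_sum_gt0. Qed.

Lemma H1_mxE i j : (\sum_k A i k) * H1_mx A i j = A i j.
Proof.
have U : Delta_mx A \in unitmx.
  rewrite unitmxE det_diag unitfE; apply/prodf_neq0 => k _.
  by rewrite mxE gt_eqF // row_sum_gt0.
have /matrixP/(_ i j) : Delta_mx A *m H1_mx A = A by rewrite mulKVmx.
by rewrite mul_diag_mx !mxE.
Qed.

Lemma edge_weightE i j : w i j = mass w i * H1_mx A i j.
Proof. by rewrite mass_edge_weight -mulrA H1_mxE. Qed.

(** The symmetrizer is [mass], the diagonal of D Delta, because D Delta [H1] = D A. *)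
Lemma H1_symmetrizable : symmetrizable_mx (H1_mx A).
Proof.
exists (\row_i mass w i); split=> [i|]; first by rewrite mxE mass_edge_weight_gt0.
apply/is_hermitianmxP; rewrite expr0 scale1r map_mx_id //.
have E i j : (diag_mx (\row_i mass w i) *m H1_mx A) i j = w i j.
  by rewrite mul_diag_mx mxE [X in X * _]mxE -edge_weightE.
by apply/matrixP => i j; rewrite [RHS]mxE !E edge_weight_sym.
Qed.

(** [eigenvalue] concerns row vectors: a left eigenvector of [H1_mx A] is [mass] times an
    eigenvector of the pencil. *)
Lemma H1_spectrumP a : reflect
  (exists2 u : 'I_n -> R, (exists i, u i != 0) &
    forall i, \sum_j w i j * u j = a * (mass w i * u i))
  (a \in spectrum (H1_mx A)).
Proof.
rewrite -root_prod_XsubC -(symmetrizable_spectrum H1_symmetrizable).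
rewrite -eigenvalue_root_char.
have m0 i : mass w i != 0 by rewrite gt_eqF // mass_edge_weight_gt0.
apply: (iffP eigenvalueP) => [[v Ev v0]|[u [i ui] Eu]].
- exists (fun i => v 0 i / mass w i).
    by move/rV0Pn: v0 => [i vi]; exists i; rewrite mulf_neq0 ?invr_neq0.
  move=> i; have := congr1 (fun M : 'rV_n => M 0 i) Ev; rewrite !mxE => Ei.
  rewrite [mass w i * _]mulrC divfK // -Ei; apply: eq_bigr => j _.
  by rewrite edge_weight_sym edge_weightE; field.
- exists (\row_i (mass w i * u i)).
    apply/rowP => j; rewrite !mxE -Eu; apply: eq_bigr => k _.
    by rewrite mxE edge_weight_sym edge_weightE; ring.
  by apply/rV0Pn; exists i; rewrite mxE mulf_neq0.
Qed.

Lemma H1_eigenvalue_le1 a : a \in spectrum (H1_mx A) -> a <= 1.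
Proof.
case/H1_spectrumP => u [i ui] Eu.
have M0 : 0 < wsum w (fun i => u i ^+ 2).
  exact: (wsum_sqr_gt0 mass_edge_weight_gt0 ui).
rewrite -(ler_pM2r M0) mul1r.
have -> : a * wsum w (fun i => u i ^+ 2) = wform w u u.
  by rewrite wformE mulr_sumr; apply: eq_bigr => j _; rewrite Eu; ring.
exact: wform_le_wsum edge_weight_ge0 edge_weight_sym _.
Qed.

Lemma H1_spectrum1 : 1 \in spectrum (H1_mx A).
Proof.
apply/H1_spectrumP; exists (fun=> 1).
  by exists (Ordinal n_gt1); exact: oner_neq0.
by move=> i; rewrite mul1r mulr1; apply: eq_bigr => j _; rewrite mulr1.
Qed.

(** Index [n.-1] counted from 1, so position [n.-2] of the sorted list. *)
Let lam := eigval (H1_mx A) n.-1.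

Lemma size_H1_spectrum : size (spectrum (H1_mx A)) = n.
Proof. exact: size_spectrum H1_symmetrizable. Qed.

Lemma H1_second_mem : lam \in spectrum (H1_mx A).
Proof. by rewrite mem_nth // size_H1_spectrum; lia. Qed.

(** The value 1 is in the sorted list and [a] occurs strictly before it, hence not in the last
    position. *)
Lemma H1_eigenvalue_le_second a : a \in spectrum (H1_mx A) -> a < 1 -> a <= lam.
Proof.
move=> aS a1; rewrite -(nth_index 0 aS).
have iS := aS; rewrite -index_mem size_H1_spectrum in iS.
have i1 := H1_spectrum1; rewrite -index_mem size_H1_spectrum in i1.
have le_nth := sorted_leq_nth le_trans (@lexx _ R) 0 (sorted_spectrum (H1_mx A)).
have idx x y : (x < y -> y < n -> x <= n.-1.-1)%N by lia.
apply: (le_nth _ _); rewrite ?inE ?size_H1_spectrum; [exact: iS|lia|].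
apply: (idx _ _ _ i1).
rewrite ltnNge; apply/negP => ge.
have := le_nth _ _ _ _ ge; rewrite !inE !size_H1_spectrum => /(_ i1 iS).
by rewrite !nth_index // ?H1_spectrum1 // leNgt a1.
Qed.

(** If [lam] were 1, the last eigenvalue, squeezed between [lam] and 1, would be 1 too, and 1 would
    be at least a double root. *)
Lemma H1_second_lt1 : mup lam (char_poly (H1_mx A)) = 1%N -> lam < 1.
Proof.
rewrite (symmetrizable_spectrum H1_symmetrizable) mu_prod_XsubC => c1.
rewrite lt_def H1_eigenvalue_le1 ?H1_second_mem // andbT eq_sym; apply/eqP => l1.
have sS := size_H1_spectrum; move: c1; rewrite l1.
have -> : spectrum (H1_mx A) = take n.-2 (spectrum (H1_mx A)) ++ [:: 1; 1].
  rewrite -{1}(cat_take_drop n.-2 (spectrum (H1_mx A))); congr (_ ++ _).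
  have n2 : (n.-2 < n)%N by lia.
  have n1 : (n.-2.+1 < n)%N by lia.
  rewrite (drop_nth 0) ?sS // (drop_nth 0) ?sS // drop_oversize ?sS; last by lia.
  have l1' : (spectrum (H1_mx A))`_n.-2 = 1 by exact: l1.
  rewrite l1'; congr [:: _; _]; apply/eqP; rewrite eq_le.
  rewrite H1_eigenvalue_le1 ?mem_nth ?sS //= -[leLHS]l1'.
  apply: (sorted_leq_nth le_trans (@lexx _ R) 0 (sorted_spectrum (H1_mx A))) => //;
    by rewrite inE sS.
by rewrite count_cat /= eqxx; lia.
Qed.

(** Row [i] is multiplied by the positive [d 0 i], which produces the symmetric weights and clears
    the inverse in [H1_mx]. *)
Lemma equilibriumE (psi : 'I_n -> R -> R) (p : R) (x : 'cV[R]_n) :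
  equilibrium (vfield A psi p) x <->
  forall i, mass w i * x i 0 = p * \sum_j w i j * psi j (x j 0).
Proof.
have E i : d 0 i * vfield A psi p x i 0 =
    p * (\sum_j w i j * psi j (x j 0)) - mass w i * x i 0.
  rewrite /vfield mul_diag_mx !mxE mass_edge_weight mulrDr mulrDr addrC !mulrN.
  rewrite [X in _ - X]mulrA; congr (_ - _).
  transitivity (p * (d 0 i * ((\sum_j A i j) * \sum_j H1_mx A i j * psi_vec psi x j 0))).
    by ring.
  congr (p * _); rewrite [X in _ * X]mulr_sumr mulr_sumr; apply: eq_bigr => j _.
  by rewrite [psi_vec _ _ _ _]mxE /w /edge_weight -H1_mxE; ring.
split=> [x0 i|Ex].
  by apply/eqP; rewrite eq_sym -subr_eq0 -E x0 mxE mulr0.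
apply/colP => i; rewrite [RHS]mxE; apply/eqP.
by rewrite -(mulrI_eq0 _ (mulfI (lt0r_neq0 (d_gt0 i)))) E Ex subrr.
Qed.

End Translation.

Lemma sigmoidal_sqr_lt (R : realType) (f : R -> R) (x : R) : sigmoidal f ->
  f x != 0 -> f x ^+ 2 < x * f x.
Proof.
move=> sf; have f0 := sigmoidal0 sf.
have key z : 0 < z -> f z ^+ 2 < z * f z.
  move=> z0; rewrite expr2 ltr_pM2r ?sigmoidal_lt_id //.
  by rewrite -f0 sigmoidal_mono_lt.
case: (ltgtP x 0) => [x0|x0|->]; last by rewrite f0 eqxx.
- have nx : 0 < - x by lra.
  by have := key _ nx; rewrite (sigmoidal_odd sf) sqrrN mulrNN.
- by move=> _; exact: key.
Qed.

(** * From a sign-changing equilibrium to an eigenvalue *)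

Section Necessity.
Variables (R : realType) (n : nat) (w : 'I_n -> 'I_n -> R) (psi : 'I_n -> R -> R).
Hypothesis w_ge0 : forall i j, 0 <= w i j.
Hypothesis w_sym : forall i j, w i j = w j i.
Hypothesis w_conn : forall P : pred 'I_n, (exists i, P i) ->
  (forall i j, P i -> 0 < w i j -> P j) -> forall i, P i.
Hypothesis mass_gt0 : forall i, 0 < mass w i.
Hypothesis psi_sig : forall i, sigmoidal (psi i).

(** The test vector bounds the Rayleigh maximum [l] from below. The value [l = 1] is excluded: [v]
    would be a nonzero constant, against [wsum w v = 0]. *)
Lemma sign_changing_equilibrium_eigenvalue (p : R) (x : 'I_n -> R) : 0 < p ->
  (forall i, mass w i * x i = p * \sum_j w i j * psi j (x j)) ->
  (exists i, 0 < x i) -> (exists i, x i < 0) ->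
  exists l (v : 'I_n -> R), [/\ exists i, v i != 0,
    forall i, \sum_j w i j * v j = l * (mass w i * v i), l < 1 & 1 < p * l].
Proof.
move=> p0 eq [i i0] [j j0].
have [||u [u0 u1]] := @sign_changing_test_vector R n w w_ge0 w_sym mass_gt0 p x
    (fun k => psi k (x k)) p0 eq (fun k => @sigmoidal_sqr_lt R _ _ (psi_sig k)).
- by exists i; rewrite -(sigmoidal0 (psi_sig i)) sigmoidal_mono_lt.
- by exists j; rewrite -(sigmoidal0 (psi_sig j)) sigmoidal_mono_lt.
have [k uk] : exists k, u k != 0.
  have [//|/forallNP H] := pselect (exists k, u k != 0).
  have {}H k : u k = 0 by apply/eqP/negPn/negP/H.
  move: u1; rewrite /wsum /wform !big1 ?mulr0 ?ltxx // => k _.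
    by rewrite big1 // => l _; rewrite H mul0r mulr0.
  by rewrite H expr0n mulr0.
have [l [v [[m vm] Ev v0 ray]]] := rayleigh_max w_sym mass_gt0 u0 uk.
have Evv : wform w v v = l * wsum w (fun i => v i ^+ 2).
  by rewrite wformE mulr_sumr; apply: eq_bigr => q _; rewrite Ev; ring.
exists l, v; split=> //; first by exists m.
  rewrite lt_neqAle -(ler_pM2r (wsum_sqr_gt0 mass_gt0 vm)) mul1r -Evv wform_le_wsum // andbT.
  apply/eqP => l1; have vc : forall a b, v a = v b.
    by apply: (wform_eq_wsum_const w_ge0 w_sym w_conn); rewrite Evv l1 mul1r.
  move/eqP: v0; rewrite /wsum (eq_bigr (fun q => mass w q * v m)); last first.
    by move=> q _; rewrite (vc q m).
  rewrite -mulr_suml mulf_eq0 (negPf vm) orbF => /eqP S0.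
  have : 0 < \sum_q mass w q.
    rewrite (bigD1 m) //= ltr_pwDl //; apply: sumr_ge0 => q _; exact: ltW.
  by rewrite S0 ltxx.
have := ray u u0; rewrite -(ler_pM2l p0) => /(lt_le_trans u1).
by rewrite mulrA -[X in X < _]mul1r ltr_pM2r // (wsum_sqr_gt0 mass_gt0 uk).
Qed.

End Necessity.

Theorem theorem6 (R : realType) (n : nat) (hn : (0 < n)%N)
  (A : 'M[R]_n) (psi : 'I_n -> R -> R)
  (A_ge0 : nonneg_mx A) (A_irr : irreducible_mx A)
  (A_sym : symmetrizable_mx A) (A_diag : null_diag A)
  (psi_sig : forall i, sigmoidal (psi i))
  (lam_simple : mup (eigval (H1_mx A) n.-1) (char_poly (H1_mx A)) = 1%N)
  (lam_gt0 : 0 < eigval (H1_mx A) n.-1) :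
  let pi2 := (eigval (H1_mx A) n.-1)^-1 in
  1 < pi2 /\
  forall p : R, 0 < p ->
    ((exists K : set 'cV[R]_n,
        [/\ is_orthant K, K <> pos_orthant R n, K <> neg_orthant R n
          & exists x : 'cV[R]_n,
              [/\ K x, ~ (pos_orthant R n `|` neg_orthant R n) x
                & equilibrium (vfield A psi p) x]])
     <-> pi2 < p).
Proof.
move=> pi2; have n_gt1 := irreducible_gt1 hn A_irr A_diag.
have [d [d_gt0 dA_sym]] := A_sym.
have w_ge0 := edge_weight_ge0 A_ge0 d_gt0.
have w_sym := edge_weight_sym dA_sym.
have w_conn := edge_weight_conn A_ge0 A_irr d_gt0.
have m_gt0 := mass_edge_weight_gt0 n_gt1 A_ge0 A_irr d_gt0.
set lam := eigval _ _ in lam_simple lam_gt0 pi2 *.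
have lam_lt1 := H1_second_lt1 n_gt1 A_ge0 A_irr d_gt0 dA_sym lam_simple.
have eqE := equilibriumE n_gt1 A_ge0 A_irr d_gt0.
split=> [|p p0]; first by rewrite /pi2 invf_gt1.
have pi2E : (pi2 < p) = (1 < p * lam) by rewrite /pi2 -ltr_pdivrMr // div1r.
rewrite pi2E; split.
  move=> [K [_ _ _ [x [_ xPN /eqE Ex]]]].
  have [||l [v [v0 Ev l1 pl]]] := sign_changing_equilibrium_eigenvalue
      w_ge0 w_sym w_conn m_gt0 psi_sig p0 Ex.
  - have [//|/forallNP H] := pselect (exists i, 0 < x i 0).
    case: xPN; right => i; rewrite mulN1r oppr_ge0 leNgt; apply/negP; exact: H.
  - have [//|/forallNP H] := pselect (exists i, x i 0 < 0).
    case: xPN; left => i; rewrite mul1r leNgt; apply/negP; exact: H.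
  apply: lt_le_trans pl _; rewrite ler_pM2l //.
  apply: (H1_eigenvalue_le_second n_gt1 A_ge0 A_irr d_gt0 dA_sym) => //.
  by apply/(H1_spectrumP n_gt1 A_ge0 A_irr d_gt0 dA_sym); exists v.
move=> plam.
have /(H1_spectrumP n_gt1 A_ge0 A_irr d_gt0 dA_sym)[v v0 Ev] :=
  H1_second_mem n_gt1 A_ge0 A_irr d_gt0 dA_sym.
(* Summing the eigenvalue equation over [i] multiplies [wsum] by [lam], which differs from 1. *)
have v_orth : wsum (edge_weight A d) v = 0.
  have E : wsum (edge_weight A d) v = lam * wsum (edge_weight A d) v.
    rewrite {1}wsum_double_sym // mulr_sumr; apply: eq_bigr => i _; exact: Ev.
  by apply/eqP; rewrite -(mulrI_eq0 _ (mulfI (_ : 1 - lam != 0)));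
    [rewrite mulrBl mul1r -E subrr|rewrite subr_eq0 gt_eqF].
have [x [Ex [i i0] [j j0]]] := sign_changing_equilibrium_exists
  w_ge0 w_sym w_conn m_gt0 psi_sig p0 Ev v_orth v0 plam.
pose X : 'cV[R]_n := \col_i x i.
have XE k : X k 0 = x k by rewrite mxE.
(* The sign pattern of [x], with zero coordinates counted as positive. *)
pose k i : R := if 0 <= x i then 1 else -1.
have KX : orthant k X.
  move=> q; rewrite XE /k; case: (leP 0 (x q)) => xq; first by rewrite mul1r.
  by rewrite mulN1r oppr_ge0 ltW.
have Xpos : ~ pos_orthant R n X.
  by move=> /(_ j); rewrite XE mul1r leNgt j0.
have Xneg : ~ neg_orthant R n X.
  by move=> /(_ i); rewrite XE mulN1r oppr_ge0 leNgt i0.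
exists (orthant k); split.
- exists k; split=> // q; rewrite /k; case: ifP => _; by [left|right].
- by move=> E; apply: Xpos; rewrite -E.
- by move=> E; apply: Xneg; rewrite -E.
exists X; split=> //; first by case.
apply/eqE => q; rewrite XE Ex; congr (_ * _); apply: eq_bigr => r _.
by rewrite XE.
Qed.
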